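(* Let $p \in [1,\infty)$ and, for every $M>0$, let $u_M \in \hat C$ be a minimizer of $J_M$ over $\hat C$. Then for every increasing sequence $(M_n)_{n\in\mathbb{N}}$ of positive reals with $M_n\to\infty$, the sequence $(u_{M_n})_{n\in\mathbb{N}}$ possesses an accumulation point in $W^{1,p}_{\mathrm{loc}}(\Omega)$. Every such accumulation point is a minimizer of $J_\infty$ over $\hat C$. Moreover, \[ \lim_{M\to\infty} J_M(u_M) = \min_{u\in\hat C} J_\infty(u) < \infty . \]
   Context: Let $\Omega\subset\mathbb{R}^n$ be a compact convex set with nonempty interior. $\hat C$ denotes the set of all functions $u\colon\Omega\to[-1,0]$ that are convex and closed (i.e. lower semicontinuous). Each such $u$ is locally Lipschitz in $\operatorname{int}\Omega$, hence differentiable a.e. For $M>0$ and $u\in\hat C$ define \[ J_M(u) = \int_\Omega \frac{1}{|\nabla u(x)|^2+M^{-2}}\,dx, \qquad J_\infty(u)=\int_\Omega \frac{1}{|\nabla u(x)|^2}\,dx \in [0,\infty], \] where the integrand of $J_\infty$ is taken to be $+\infty$ where $\nabla u=0$. The space $W^{1,p}_{\mathrm{loc}}(\Omega)$ consists of functions $u\colon\Omega\to\mathbb{R}$ with $u\in W^{1,p}(K)$ for all compact $K\subset\operatorname{int}\Omega$; $u_n\to u$ in $W^{1,p}_{\mathrm{loc}}(\Omega)$ means $u_n\to u$ in $W^{1,p}(K)$ for every compact $K\subset\operatorname{int}\Omega$. An accumulation point of a sequence is a limit of some subsequence in this sense; as usual, elements of this space agreeing a.e. are identified, and a convex function is represented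 by its closed (lower semicontinuous) version on $\Omega$. It is known that minimizers of $J_M$ over $\hat C$ exist for each $M>0$. *)

(* Defs.v *)
From HB Require Import structures.
From mathcomp Require Import all_boot all_order all_algebra.
From mathcomp Require Import all_classical all_reals all_analysis.
Import Order.TTheory GRing.Theory Num.Theory.
Import numFieldNormedType.Exports.

Set Implicit Arguments.
Unset Strict Implicit.
Unset Printing Implicit Defensive.

Local Open Scope classical_set_scope.
Local Open Scope ring_scope.

Definition rV_display : measure_display -> measure_display.
Proof. exact. Qed.

(* The product sigma-algebra on row vectors: over R it is the Borel
   sigma-algebra of R^n. *)
Section measurable_rV.
Context {d} {T : measurableType d} (n : nat).

Let coords : 'I_n -> 'rV[T]_n -> T := fun i x => x ord0 i.

Let rV_set0 : g_sigma_preimage coords set0.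
Proof. exact: sigma_algebra0. Qed.

Let rV_setC A : g_sigma_preimage coords A -> g_sigma_preimage coords (~` A).
Proof. exact: sigma_algebraC. Qed.

Let rV_bigcup (F : _^nat) : (forall i, g_sigma_preimage coords (F i)) ->
  g_sigma_preimage coords (\bigcup_i (F i)).
Proof. exact: sigma_algebra_bigcup. Qed.

HB.instance Definition _ := @isMeasurable.Build (rV_display d)
  'rV[T]_n (g_sigma_preimage coords) rV_set0 rV_setC rV_bigcup.

Lemma measurable_coord (i : 'I_n) :
  measurable_fun [set: 'rV[T]_n] (fun v : 'rV[T]_n => v ord0 i).
Proof.
move=> _ A mA; rewrite setTI; apply: sub_sigma_algebra => /=.
rewrite -bigcup_seq/=; exists i => /=; first by rewrite mem_index_enum.
by exists A => //; rewrite setTI.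
Qed.

Lemma measurable_fun_rV d' (S : measurableType d') (f : S -> 'rV[T]_n) :
  (forall i, measurable_fun [set: S] (fun x => f x ord0 i)) ->
  measurable_fun [set: S] f.
Proof.
move=> mf; apply: (@measurability _ _ _ _ _ _
  (\big[setU/set0]_(i < n) preimage_set_system setT (coords i) measurable)).
  by [].
move=> _ [B + <-]; rewrite -bigcup_seq/= => -[i _ [A mA <-]].
by rewrite setTI setTI -comp_preimage -[X in measurable X]setTI; exact: mf.
Qed.

End measurable_rV.

Section lebesgue_rV.
Context {R : realType}.

Definition rV_snoc n (x : 'rV[R]_n * R) : 'rV[R]_n.+1 :=
  \row_i if unlift ord_max i is Some j then x.1 ord0 j else x.2.

Lemma measurable_rV_snoc n : measurable_fun setT (@rV_snoc n).
Proof.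
apply: measurable_fun_rV => i.
under eq_fun do rewrite mxE.
case: (unlift ord_max i) => [j|]; last exact: measurable_snd.
exact: (measurableT_comp (measurable_coord j)).
Qed.

(* Lebesgue measure on R^n, on Borel sets: the n-fold product of the Lebesgue
   measure of R. *)
Fixpoint lebesgue_rV (n : nat) : {measure set 'rV[R]_n -> \bar R} :=
  match n with
  | 0 => dirac (0 : 'rV[R]_0)
  | m.+1 => @measure_function_pushforward__canonical__measure_function_Measure
      _ _ _ _ _ (lebesgue_rV m \x lebesgue_measure)%E (@rV_snoc m)
      (@measurable_rV_snoc m)
  end.

Lemma lebesgue_rV_box n (A : 'I_n -> set R) :
  (forall i, measurable (A i)) ->
  lebesgue_rV n [set v | forall i, A i (v ord0 i)] =
  (\prod_(i < n) lebesgue_measure (A i))%E.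
Proof.
elim: n A => [|n IHn] A mA.
  by rewrite big_ord0 /= diracE mem_set// => -[].
pose B := [set v : 'rV[R]_n |
  forall i, A (widen_ord (leqnSn n) i) (v ord0 i)].
have mB : measurable B.
  have -> : B = \bigcap_(i in [set: 'I_n])
      ((fun v : 'rV[R]_n => v ord0 i) @^-1` A (widen_ord (leqnSn n) i)).
    by apply/seteqP; split=> [v Bv i _|v Bv i]; exact: Bv.
  apply: fin_bigcap_measurable => [|i _]; first exact: finite_finset.
  by rewrite -[X in measurable X]setTI; exact: measurable_coord.
rewrite big_ord_recr/= -IHn; last by move=> i; exact: mA.
rewrite -(product_measure1E (lebesgue_rV n) lebesgue_measure mB (mA ord_max)).
rewrite /pushforward; congr (product_measure1 _ _ _); apply/seteqP; split.
  move=> [v x] /= Avx; split=> [i|].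
    have := Avx (widen_ord (leqnSn n) i); rewrite mxE.
    have -> : widen_ord (leqnSn n) i = lift ord_max i.
      by apply: val_inj; rewrite /= /bump leqNgt ltn_ord.
    by rewrite liftK.
  by have := Avx ord_max; rewrite mxE unlift_none.
move=> [v x] /= [Av Ax] i; rewrite mxE; case: unliftP => [j|] ->//=.
suff -> : lift ord_max j = widen_ord (leqnSn n) j by exact: Av.
by apply: val_inj; rewrite /= /bump leqNgt ltn_ord.
Qed.

End lebesgue_rV.

Section functionals.
Context {R : realType} {n : nat}.
Local Notation Rn := 'rV[R]_n.
Local Notation mu := (lebesgue_rV n).
Implicit Types (Omega K U : set Rn) (u v w f phi : Rn -> R).

(* The classical gradient. A function on Omega is encoded as a total function
   whose values outside Omega are irrelevant, so the gradient is only formed at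
   interior points of Omega where u is differentiable. For convex u the other
   points of Omega form a null set; the value 0 there is immaterial. *)
Definition gradient Omega u (x : Rn) : Rn :=
  if `[< Omega° x /\ differentiable u x >]
  then \row_i 'D_(delta_mx ord0 i) u x else 0.

(* Squared Euclidean norm; the library norm of 'rV[R]_n is the sup norm. *)
Definition sqnorm (y : Rn) : R := \sum_(i < n) y ord0 i ^+ 2.

(* The functions Omega -> [-1, 0] that are convex and lower semicontinuous on
   Omega; semicontinuity is relative to Omega (subspace topology). *)
Definition Chat Omega : set (Rn -> R) :=
  [set u | [/\ forall x, Omega x -> -1 <= u x <= 0,
               convex_function Omega u &
               lower_semicontinuous
                 ((fun x => (u x)%:E) : subspace Omega -> \bar R)]].

Definition J Omega (M : R) u : \bar R :=
  (\int[mu]_(x in Omega) ((sqnorm (gradient Omega u x) + M ^- 2)^-1)%:E)%E.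

Definition Jinf Omega u : \bar R :=
  (\int[mu]_(x in Omega)
     let g2 := sqnorm (gradient Omega u x) in
     if g2 == 0%R then +oo else (g2^-1)%:E)%E.

Definition minimizer (C : set (Rn -> R)) (F : (Rn -> R) -> \bar R) u :=
  C u /\ forall v, C v -> (F u <= F v)%E.

Definition iter_partial (s : seq 'I_n) phi : Rn -> R :=
  foldr (fun i psi => 'D_(delta_mx ord0 i) psi) phi s.

(* phi is C^oo on R^n: all iterated partial derivatives exist and are
   continuous. *)
Definition smooth phi :=
  forall s : seq 'I_n, continuous (iter_partial s phi) /\
    forall i x, derivable (iter_partial s phi) x (delta_mx ord0 i).

Definition test_function U phi :=
  let supp := closure [set x | phi x != 0] in
  [/\ smooth phi, compact supp & supp `<=` U].

(* L^p norm over U: integrate the extension by 0 of f outside U. *)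
Definition Lpnorm (p : R) U f : \bar R :=
  'N[mu]_(p%:E)[(fun x => (f x)%:E) \_ U]%E.

Definition Lp (p : R) U f := measurable_fun U f /\ (Lpnorm p U f < +oo)%E.

(* f is in W^{1,p}(U), U open, with weak gradient g. *)
Definition W1p_gradient (p : R) U f (g : Rn -> Rn) :=
  [/\ Lp p U f, forall i, Lp p U (fun x => g x ord0 i) &
      forall phi i, test_function U phi ->
        (\int[mu]_(x in U) (f x * 'D_(delta_mx ord0 i) phi x)%:E =
         - \int[mu]_(x in U) (g x ord0 i * phi x)%:E)%E].

Definition W1p (p : R) U f := exists g, W1p_gradient p U f g.

(* Weak gradients are unique up to null sets, so the choice of the witnesses
   is immaterial. *)
Definition cvg_W1p (p : R) U (f_ : nat -> Rn -> R) f :=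
  exists (g_ : nat -> Rn -> Rn) (g : Rn -> Rn),
    [/\ forall k, W1p_gradient p U (f_ k) (g_ k),
        W1p_gradient p U f g,
        Lpnorm p U (fun x => f_ k x - f x) @[k --> \oo] --> 0%E &
        forall i, Lpnorm p U (fun x => g_ k x ord0 i - g x ord0 i)
          @[k --> \oo] --> 0%E].

(* For compact K, W^{1,p}(K) is read as W^{1,p} of the open set int K. *)
Definition W1p_loc (p : R) Omega f :=
  forall K, compact K -> K `<=` Omega° -> W1p p K° f.

Definition cvg_W1p_loc (p : R) Omega (f_ : nat -> Rn -> R) f :=
  forall K, compact K -> K `<=` Omega° -> cvg_W1p p K° f_ f.

Definition accumulation_point (p : R) Omega (f_ : nat -> Rn -> R) f :=
  W1p_loc p Omega f /\
  exists s : nat -> nat, {homo s : i j / (i < j)%N} /\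
    cvg_W1p_loc p Omega (fun k => f_ (s k)) f.

End functionals.

(* Main.v *)
From HB Require Import structures.
Require Import Defs.
From mathcomp Require Import all_boot all_order all_algebra.
From mathcomp Require Import all_classical all_reals all_analysis.
From mathcomp Require Import measurable_realfun.
From mathcomp Require Import ring lra.
Import Order.TTheory GRing.Theory Num.Theory.
Import numFieldNormedType.Exports.

(** Everything rests on two elementary facts about functions u from Omega to
    [-1, 0] that are convex.  First, if the closed ball of radius r around x
    lies in Omega, then u moves by at most |y - x| / r between x and y in that
    ball; the constant does not depend on u, so the class is locally
    equi-Lipschitz.  Second, difference quotients along a direction e increase
    with the step, so the one-sided derivative dplus u e x is an infimum of
    difference quotients.  It is therefore upper semicontinuous along pointwise
    convergence, and since - dplus u (- e) <= dplus u e, pointwise convergence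
    u_k -> w forces dplus u_k e x -> dplus w e x at each point x where w is
    differentiable (dplus_limit).

    Compactness (Chat_sequentially_compact): a cluster point of the sequence in
    the product topology is convex on Omega; a subsequence that converges to it
    on the rational points converges on the whole interior by
    equi-Lipschitz continuity; the lower semicontinuous envelope of the cluster
    point agrees with it in the interior and lies in the class.

    Null sets (null_disjoint_shifts): a bounded measurable set N that is
    disjoint from its translates N + s e, 0 < s <= 1, is null, since infinitely
    many disjoint translates fit into a bounded set.  Two applications: the set
    where - dplus u (- e) x < q < dplus u e x meets each line of direction e at
    most once, so convex functions are differentiable almost everywhere
    (ae_smooth_points), and a piece of the boundary of Omega is pushed into the
    interior by a suitable d, so the boundary is null (boundary_negligible).

    Sobolev convergence (Chat_cvg_W1p): dplus is the weak gradient
    (weak_gradient_dplus): translation invariance moves the difference quotient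
    from u to the test function, and both sides pass to the limit under a
    common bound.  Dominated convergence turns the almost everywhere
    convergence of functions and gradients into local convergence in every
    W^{1,p} with finite p.

    Energies: J_M increases to J_infinity, so for minimizers u_M and every v in
    the class J_M(u_M) <= J_M(v) <= J_infinity(v).  If u_{M_k} -> w in the
    interior, the integrands converge almost everywhere (to +oo where the
    gradient of w vanishes), and Fatou gives
    J_infinity(w) <= liminf J_{M_k}(u_{M_k}) (Jinf_fatou).  Both together show
    that w minimizes J_infinity; M |-> J_M(u_M) is nondecreasing, so its limit is
    J_infinity(w).  The minimum is finite because a nonconstant affine function,
    whose gradient is a nonzero constant, competes (Chat_finite_energy).
    Finally, an accumulation point in W^{1,p}_loc coincides almost everywhere
    with such a pointwise limit w (W1p_loc_limit_unique). *)

Set Implicit Arguments.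
Unset Strict Implicit.
Unset Printing Implicit Defensive.

Local Open Scope classical_set_scope.
Local Open Scope ring_scope.

(** * Lebesgue measure on row vectors *)

Section rV_measure.
Context {R : realType} {n : nat}.
Local Notation Rn := 'rV[R]_n.

Lemma rV_ballE (x y : Rn) (r : R) : 0 < r ->
  ball x r y <-> forall i, `|x ord0 i - y ord0 i| < r.
Proof.
move=> r0; split => [[_ xy] i|xy]; first exact: xy.
by split => // i j; rewrite ord1; exact: xy.
Qed.

Lemma rV_coord_le_norm (x : Rn) (i : 'I_n) : `|x ord0 i| <= `|x|.
Proof.
rewrite [leRHS]/Num.norm /= mx_normrE.
exact: (le_bigmax _ (fun ij => `|x ij.1 ij.2|) (ord0, i)).
Qed.

(** The balls with rational centre and radius 1/(m+1) form a countable base.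
    The doubled ball inside A serves two later uses: it contains the closed
    ball of radius 1/(m+1), and its centre lies in A. *)
Lemma rational_ball (A : set Rn) (x : Rn) : nbhs x A ->
  exists (c : 'rV[rat]_n) (m : nat),
    ball (map_mx ratr c : Rn) m.+1%:R^-1 x /\
    ball (map_mx ratr c : Rn) (m.+1%:R^-1 *+ 2) `<=` A.
Proof.
move=> /nbhs_ballP [e /= e0 eA].
have [m me] : exists m, m.+1%:R^-1 < e / 3.
  have e3 : 0 < e / 3 by rewrite divr_gt0.
  have [m _ H] := near_infty_natSinv_lt (PosNum e3).
  by exists m; exact: H (leqnn m).
have m0 : 0 < m.+1%:R^-1 :> R by rewrite invr_gt0.
suff [c Hc] : exists c : 'rV[rat]_n,
    ball (map_mx ratr c : Rn) m.+1%:R^-1 x /\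
    ball (map_mx ratr c : Rn) (m.+1%:R^-1 *+ 2) `<=` A by exists c, m.
move: m0 me; set r := _^-1 => m0 me.
have /choice [c xc] (i : 'I_n) : exists q : rat,
    `|ratr q - x ord0 i| < r.
  have [|q] := @rat_in_itvoo R (x ord0 i - r) (x ord0 i + r).
    by lra.
  by rewrite in_itv/= => /andP[? ?]; exists q; rewrite ltr_norml; apply/andP; lra.
exists (\row_i c i); split.
  by apply/rV_ballE => // i; rewrite !mxE.
move=> y /rV_ballE; rewrite mulr2n => cy; apply: eA; apply/rV_ballE => // i.
have := cy (addr_gt0 m0 m0) i; have := xc i; rewrite !mxE => xci.
rewrite !ltr_norml in xci * => /andP[? ?]; move/andP: xci => [? ?].
by apply/andP; lra.
Qed.

(** The norm is the sup norm, so a ball is a box of coordinate intervals. *)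
Lemma measurable_rV_ball (x : Rn) (r : R) : measurable (ball x r).
Proof.
have [r0|r0] := ltP 0 r; last first.
  rewrite (_ : ball x r = set0) //; apply/seteqP; split => // y.
  by move=> [/lt_geF]; rewrite r0.
rewrite (_ : ball x r = \bigcap_(i in [set: 'I_n])
   ((fun v : Rn => v ord0 i) @^-1` ball (x ord0 i) r)).
  apply: fin_bigcap_measurable => [|i _]; first exact: finite_finset.
  by rewrite -[X in measurable X]setTI; apply: measurable_coord => //;
    apply: open_measurable; exact: ball_open.
by apply/seteqP; split => [y /rV_ballE H i _|y H]; [exact: H|
  apply/rV_ballE => // i; exact: H].
Qed.

Lemma open_measurable_rV (A : set Rn) : open A -> measurable A.
Proof.
move=> oA.
pose B (k : 'rV[rat]_n * nat) : set Rn :=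
  if `[< ball (map_mx ratr k.1 : Rn) k.2.+1%:R^-1 `<=` A >]
  then ball (map_mx ratr k.1 : Rn) k.2.+1%:R^-1 else set0.
suff AB : A = \bigcup_k B k.
  rewrite [X in measurable X]AB.
  apply: (@countable_bigcupT_measurable _ _ _ B) => [|k]; first exact: countableP.
  by rewrite /B; case: asboolP => // _; exact: measurable_rV_ball.
apply/seteqP; split => x.
  move=> Ax; have [c [m [xc cA]]] := rational_ball (open_nbhs_nbhs (conj oA Ax)).
  exists (c, m) => //; rewrite /B/=; case: asboolP => // -[] y cy.
  by apply: cA; apply: le_ball cy; rewrite mulr2n lerDl.
by move=> [k _]; rewrite /B; case: asboolP => // kA; exact: kA.
Qed.

Lemma closed_measurable_rV (A : set Rn) : closed A -> measurable A.
Proof.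
by move=> cA; rewrite -(setCK A); apply: measurableC; apply: open_measurable_rV;
  exact: closed_openC.
Qed.

Lemma continuous_measurable_rV (U : set Rn) (f : Rn -> R) :
  open U -> (forall x, U x -> {for x, continuous f}) -> measurable_fun U f.
Proof.
move=> oU cf; apply: (measurability _ (RGenOInfty.measurableE R)) => _ [_ [a ->] <-].
apply: open_measurable_rV; rewrite openE => x [Ux /=]; rewrite in_itv/= andbT => afx.
apply: filterI; first exact: open_nbhs_nbhs.
have : nbhs x (f @^-1` [set y | a < y]) :=
  cf x Ux [set y | a < y] (open_nbhs_nbhs (conj (@open_gt _ a) afx)).
by apply: filterS => y /=; rewrite in_itv/= andbT.
Qed.

Lemma measurable_rV_shift (a : Rn) : measurable_fun setT (fun x : Rn => x + a).
Proof.
apply: measurable_fun_rV => i.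
under eq_fun do rewrite mxE.
apply: measurable_funD => //; exact: measurable_coord.
Qed.

End rV_measure.

(** Stated for any invariant map because the induction that proves translation
    invariance in dimension n + 1 already needs the change of variables in
    dimension n. *)
Lemma ge0_integral_invariant d (T : measurableType d) (R : realType)
    (mu : {measure set T -> \bar R}) (phi : T -> T) (F : T -> \bar R) :
  measurable_fun setT phi ->
  (forall A, measurable A -> mu (phi @^-1` A) = mu A) ->
  measurable_fun setT F -> (forall x, 0 <= F x)%E ->
  (\int[mu]_x F (phi x) = \int[mu]_x F x)%E.
Proof.
move=> mphi muphi mF F0.
have := ge0_integral_pushforward mphi mu measurableT mF (fun x _ => F0 x).
rewrite preimage_setT => <-; apply: eq_measure_integral => A mA _.
exact: muphi.
Qed.

Section lebesgue_rV_shift.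
Context {R : realType}.

(** Uniqueness of the Lebesgue measure: translation preserves the length of
    half-open intervals. *)
Lemma lebesgue_measure_shift (b : R) (A : set R) : measurable A ->
  lebesgue_measure ((fun x => x + b) @^-1` A) = lebesgue_measure A.
Proof.
move=> mA.
have mb : measurable_fun setT (fun x : measurableTypeR R => x + b : measurableTypeR R).
  exact: measurable_funD.
pose m' := measure_function_pushforward__canonical__measure_function_Measure
  lebesgue_measure mb.
apply/esym; apply: (@lebesgue_measure_unique R m') => // _ [[x y] _ <-].
rewrite /m'/= /pushforward/=.
rewrite (_ : _ @^-1` _ = `]x - b, y - b]%classic).
  have xyb : (y - b) - (x - b) = y - x by ring.
  by rewrite !lebesgue_measure_itv/= !lte_fin ltrD2r -!EFinB xyb.
by apply/seteqP; split => z /=; rewrite !in_itv/=; lra.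
Qed.

(** By slicing along the last coordinate: each slice is translated in R, and
    the base point is translated in dimension n. *)
Lemma lebesgue_rV_shift n (a : 'rV[R]_n) (A : set 'rV[R]_n) : measurable A ->
  lebesgue_rV n ((fun x => x + a) @^-1` A) = lebesgue_rV n A.
Proof.
elim: n a A => [|n IH] a A mA /=.
  rewrite (_ : _ @^-1` A = A) //; apply/funext => x /=.
  by rewrite (thinmx0 (x + a)) (thinmx0 x).
pose a' : 'rV[R]_n := \row_i a ord0 (lift ord_max i).
have aE x : rV_snoc x + a = rV_snoc (x.1 + a', x.2 + a ord0 ord_max).
  apply/rowP => i; rewrite !mxE; case: unliftP => [j|] -> //=.
  by rewrite !mxE.
have mB : measurable (@rV_snoc R n @^-1` A).
  by rewrite -[X in measurable X]setTI; exact: measurable_rV_snoc.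
rewrite /pushforward/= /product_measure1.
set B := _ @^-1` A in mB *.
transitivity (\int[lebesgue_rV n]_x (lebesgue_measure \o xsection B) (x + a')%R)%E.
  apply: eq_integral => x _ /=.
  rewrite -[RHS](@lebesgue_measure_shift (a ord0 ord_max)); last first.
    exact: measurable_xsection.
  congr (lebesgue_measure _); apply/seteqP; split => t /=;
  by rewrite /xsection/= !inE /B/= aE.
rewrite (ge0_integral_invariant (@measurable_rV_shift R n a')) //.
- by move=> C mC; exact: IH.
- exact: measurable_fun_xsection.
Qed.

Lemma ge0_integral_shift n (a : 'rV[R]_n) (F : 'rV[R]_n -> \bar R) :
  measurable_fun setT F -> (forall x, 0 <= F x)%E ->
  (\int[lebesgue_rV n]_x F (x + a)%R = \int[lebesgue_rV n]_x F x)%E.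
Proof.
move=> mF F0; apply: (ge0_integral_invariant (measurable_rV_shift a)) => // A mA.
exact: lebesgue_rV_shift.
Qed.

(** Both integrals are differences of the integrals of the positive and
    negative parts, to which the nonnegative case applies. *)
Lemma integral_shift n (a : 'rV[R]_n) (F : 'rV[R]_n -> \bar R) :
  measurable_fun setT F ->
  (\int[lebesgue_rV n]_x F (x + a)%R = \int[lebesgue_rV n]_x F x)%E.
Proof.
move=> mF; rewrite [LHS]integralE [RHS]integralE; congr (_ - _)%E.
  rewrite -[RHS](ge0_integral_shift a) //; last exact: measurable_funepos.
  by rewrite -/(F \o _) funepos_comp.
rewrite -[RHS](ge0_integral_shift a) //; last exact: measurable_funeneg.
by rewrite -/(F \o _) funeneg_comp.
Qed.

Lemma lebesgue_rV_bounded_lty n (A : set 'rV[R]_n) (B : R) :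
  measurable A -> (forall x, A x -> `|x| <= B) -> (lebesgue_rV n A < +oo)%E.
Proof.
move=> mA AB.
pose I : 'I_n -> set R := fun=> `[- B, B]%classic.
have mI : measurable [set v : 'rV[R]_n | forall i, I i (v ord0 i)].
  rewrite (_ : mkset _ = \bigcap_(i in [set: 'I_n])
      ((fun v : 'rV[R]_n => v ord0 i) @^-1` I i)).
    apply: fin_bigcap_measurable => [|i _]; first exact: finite_finset.
    by rewrite -[X in measurable X]setTI; apply: measurable_coord => //; exact: measurable_itv.
  by apply/seteqP; split=> [v Bv i _|v Bv i]; exact: Bv.
apply: (@le_lt_trans _ _ (lebesgue_rV n [set v | forall i, I i (v ord0 i)])).
  apply: le_measure; [by rewrite inE|by rewrite inE|].
  move=> x Ax i; rewrite /I/= in_itv/= -ler_norml (le_trans _ (AB x Ax)) //.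
  exact: rV_coord_le_norm.
rewrite lebesgue_rV_box; last by move=> i; exact: measurable_itv.
suff /andP[] : (0 <= \prod_(i < n) lebesgue_measure (I i) < +oo)%E by [].
elim/big_ind : _ => [|x y /andP[x0 xoo] /andP[y0 yoo]|i _].
- by rewrite lee01 ltry.
- by rewrite mule_ge0 //= lte_mul_pinfty // ge0_fin_numE.
- by rewrite measure_ge0/= /I lebesgue_measure_itv; case: ifP; rewrite /= ?ltry.
Qed.

(** The translates N + e/(k+1) are pairwise disjoint, have the same measure
    and stay in a bounded set; a positive common measure would make their
    union infinite. *)
Lemma null_disjoint_shifts n (N : set 'rV[R]_n) (e : 'rV[R]_n) (B : R) :
  measurable N -> (forall x, N x -> `|x| <= B) ->
  (forall s x, 0 < s <= 1 -> N x -> ~ N (x + s *: e)) ->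
  lebesgue_rV n N = 0%E.
Proof.
move=> mN NB Ne.
pose a (k : nat) := - (k.+1%:R^-1 *: e).
pose T k := (fun x => x + a k) @^-1` N.
have mT k : measurable (T k).
  by rewrite -[X in measurable X]setTI; apply: measurable_rV_shift.
have Tdisj j k x : (j < k)%N -> T j x -> T k x -> False.
  move=> jk Tj Tk; apply: (Ne (j.+1%:R^-1 - k.+1%:R^-1) (x + a j)) => //.
    rewrite subr_gt0 ltf_pV2 ?posrE // ltr_nat ltnS jk /=.
    rewrite lerBlDr (le_trans (y := 1)) ?lerDl //.
    by rewrite invf_le1 // ler1n.
  by rewrite (_ : x + a j + _ = x + a k) // /a scalerBl addrA subrK.
have tT : trivIset setT T.
  apply/trivIsetP => j k _ _ jk; apply/seteqP; split => // x [Tj Tk].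
  by move: jk; rewrite neq_ltn => /orP[] jk; [exact: Tdisj jk Tj Tk|
    exact: Tdisj jk Tk Tj].
have mU : measurable (\bigcup_k T k) by apply: bigcupT_measurable.
have Uoo : (lebesgue_rV n (\bigcup_k T k) < +oo)%E.
  apply: (@lebesgue_rV_bounded_lty _ _ (B + `|e|)) => // x [k _ Tk].
  rewrite (_ : x = (x + a k) - a k); last by rewrite addrK.
  rewrite (le_trans (ler_normB _ _)) // lerD // ?NB //.
  rewrite /a normrN normrZ ler_piMl // ger0_norm //.
  by rewrite invf_le1 // ler1n.
have mUE : lebesgue_rV n (\bigcup_k T k) = (\sum_(0 <= i <oo) lebesgue_rV n N)%E.
  rewrite measure_bigcup //.
  rewrite (@eq_eseriesl _ _ xpredT) => [|k]; last by rewrite in_setT.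
  by apply: eq_eseriesr => k _; rewrite lebesgue_rV_shift.
rewrite mUE in Uoo.
have Nfin : lebesgue_rV n N \is a fin_num.
  rewrite ge0_fin_numE //; apply: lebesgue_rV_bounded_lty mN NB.
have sum_le k : (k%:R%:E * lebesgue_rV n N <=
   \sum_(0 <= i <oo) lebesgue_rV n N)%E.
  apply: le_trans (nneseries_lim_ge k _) => //.
  by rewrite sumr_const_nat subn0 mule_natl.
have Ufin : (\sum_(0 <= i <oo) lebesgue_rV n N)%E \is a fin_num.
  by rewrite ge0_fin_numE // nneseries_ge0.
have S0 : (0 <= \sum_(0 <= i <oo) lebesgue_rV n N)%E by rewrite nneseries_ge0.
move: sum_le Ufin S0; set S := (\sum_(0 <= i <oo) _)%E => sum_le Ufin S0.
apply/eqP; rewrite eq_le measure_ge0 andbT.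
move: sum_le; rewrite -(fineK Nfin) -(fineK Ufin) => sum_le; rewrite lee_fin leNgt.
apply/negP => c0.
have := sum_le (Num.bound (fine S / fine (lebesgue_rV n N))).
rewrite -EFinM lee_fin -ler_pdivlMr // leNgt => /negP; apply.
by apply: archi_boundP; rewrite divr_ge0 ?fine_ge0.
Qed.

End lebesgue_rV_shift.

(** * One-sided derivatives of convex functions *)

Lemma div_itv01 {R : realFieldType} (h k : R) : 0 <= h <= k -> 0 < k ->
  0 <= h / k <= 1.
Proof.
move=> /andP[h0 hk] k0; rewrite ler_pdivrMr // mul1r hk andbT.
by rewrite divr_ge0 // ltW.
Qed.

Section convex_elementary.
Context {R : realType} {V : lmodType R}.
Variables (Omega : set V) (Omega_convex : convex_set (Omega : set (convex_lmodType V))).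
Implicit Types (u : V -> R) (x y e : V) (h k t : R).

(** Convexity with a real coefficient instead of an element of the bundled
    unit interval. *)
Lemma convex_setP x y t : Omega x -> Omega y -> 0 <= t <= 1 ->
  Omega (t *: x + (1 - t) *: y).
Proof.
move=> Ox Oy /andP[t0 t1].
have := Omega_convex (Itv01 t0 t1) (mem_set Ox) (mem_set Oy).
by rewrite inE.
Qed.

Definition diffq u e h x := (u (x + h *: e) - u x) / h.

Section function.
Variables (u : V -> R)
  (u_convex : convex_function (Omega : set (convex_lmodType V)) u).

Lemma convex_functionP x y t : Omega x -> Omega y -> 0 <= t <= 1 ->
  u (t *: x + (1 - t) *: y) <= t * u x + (1 - t) * u y.
Proof.
move=> Ox Oy /andP[t0 t1].
exact: (u_convex (Itv01 t0 t1) (mem_set Ox) (mem_set Oy)).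
Qed.

Lemma diffq_mono x e h k : Omega x -> Omega (x + k *: e) -> 0 < h <= k ->
  diffq u e h x <= diffq u e k x.
Proof.
move=> Ox Ok /andP[h0 hk]; have k0 : 0 < k by exact: lt_le_trans hk.
have hk1 : 0 <= h / k <= 1 by rewrite div_itv01 // ltW.
have := convex_functionP Ok Ox hk1.
rewrite scalerDr scalerA divfK ?gt_eqF // addrAC -scalerDl.
rewrite addrCA subrr addr0 scale1r => H.
rewrite /diffq ler_pdivrMr // mulrAC -mulrA lerBlDr (le_trans H) //.
rewrite le_eqVlt; apply/orP; left; apply/eqP; ring.
Qed.

(** The chord slope just left of x is at most the one just right of x: x is a
    convex combination of x + h e and x - k e. *)
Lemma diffq_opp x e h k : Omega (x + h *: e) -> Omega (x - k *: e) ->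
  0 < h -> 0 < k -> 0 <= diffq u e h x + diffq u (- e) k x.
Proof.
move=> Oh Ok h0 k0; have hk : 0 < h + k by rewrite addr_gt0.
have t01 : 0 <= k / (h + k) <= 1.
  by rewrite div_itv01 // lerDr !ltW.
have := convex_functionP Oh Ok t01.
have -> : k / (h + k) *: (x + h *: e) + (1 - k / (h + k)) *: (x - k *: e) = x.
  rewrite !scalerDr addrACA -[_ *: x + _]scalerDl [k / _ + _]addrC subrK scale1r.
  rewrite -[- (k *: e)]scaleNr !scalerA -scalerDl -[RHS]addr0 -[X in _ = _ + X](scale0r e).
  by congr (_ + _ *: _); field; lra.
rewrite /diffq scalerN.
move: (u _) (u _) (u _) => a b c H.
have -> : (b - c) / h + (a - c) / k =
   (k / (h + k) * b + (1 - k / (h + k)) * a - c) * ((h + k) / (h * k)).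
  by field; lra.
by rewrite mulr_ge0 ?subr_ge0 // divr_ge0 ?mulr_ge0 ?ltW.
Qed.

End function.
End convex_elementary.

Section directional_derivative.
Context {R : realType} {V : normedModType R}.
Variable Omega : set V.
Implicit Types (u : V -> R) (x y e : V) (h k t : R).

(** The right derivative of u at x in direction e, written as an infimum since
    difference quotients increase with the step.  The left derivative is the
    opposite of dplus u (- e) x. *)
Definition dplus u e x :=
  inf [set diffq u e h x | h in [set h | 0 < h /\ Omega (x + h *: e)]].

Lemma interior_ray (U : set V) x e : nbhs x U ->
  exists2 h, 0 < h & forall k, `|k| <= h -> U (x + k *: e).
Proof.
move=> /nbhs_ballP[r /= r0 rU].
have e1 : 0 < `|e| + 1 by rewrite ltr_wpDl.
exists (r / 2 / (`|e| + 1)); first by rewrite !divr_gt0.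
move=> k kh; apply: rU; rewrite -ball_normE /ball_/= opprD addrA subrr add0r normrN normrZ.
apply: (@le_lt_trans _ _ (r / 2)); last by rewrite ltr_pdivrMr // ltr_pMr // ltrDl.
apply: (@le_trans _ _ (r / 2 / (`|e| + 1) * `|e|)); first by rewrite ler_wpM2r.
rewrite -mulrA ler_piMr ?divr_ge0 ?ltW // mulrC ltr_pdivrMr // mul1r ltrDl //.
Qed.

Lemma interior_pos x e : Omega° x ->
  exists2 h, 0 < h & Omega° (x + h *: e) /\ Omega (x + h *: e).
Proof.
move=> Ox; have [h h0 H] := interior_ray e (nbhs_interior Ox).
have H' : Omega° (x + h *: e) by apply: H; rewrite gtr0_norm.
by exists h => //; split => //; exact: interior_subset.
Qed.

Section function.
Variables (u : V -> R)
  (u_convex : convex_function (Omega : set (convex_lmodType V)) u).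

Lemma dplus_lbound x e k : Omega x -> 0 < k -> Omega (x - k *: e) ->
  lbound [set diffq u e h x | h in [set h | 0 < h /\ Omega (x + h *: e)]]
    (- diffq u (- e) k x).
Proof.
move=> Ox k0 Ok _ [h [h0 Oh] <-]; rewrite -subr_ge0 opprK.
exact: (diffq_opp u_convex).
Qed.

Lemma dplus_ge x e k : Omega° x -> 0 < k -> Omega (x - k *: e) ->
  - diffq u (- e) k x <= dplus u e x.
Proof.
move=> Ox k0 Ok; apply: lb_le_inf; last first.
  by apply: dplus_lbound => //; exact: interior_subset.
by have [h h0 [_ Oh]] := interior_pos e Ox; exists (diffq u e h x), h.
Qed.

Lemma dplus_le x e h : Omega° x -> 0 < h -> Omega (x + h *: e) ->
  dplus u e x <= diffq u e h x.
Proof.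
move=> Ox h0 Oh; apply: ge_inf; last by exists h.
have [k k0 [_ Ok]] := interior_pos (- e) Ox; rewrite scalerN in Ok.
exists (- diffq u (- e) k x).
by apply: dplus_lbound => //; exact: interior_subset.
Qed.

Lemma dplus_opp x e : Omega° x -> 0 <= dplus u e x + dplus u (- e) x.
Proof.
move=> Ox; rewrite -lerBlDr sub0r lerNl.
apply: lb_le_inf.
  by have [h h0 [_ Oh]] := interior_pos (- e) Ox; exists (diffq u (- e) h x), h.
move=> _ [h [h0 Oh] <-]; rewrite lerNl; apply: dplus_ge => //.
by rewrite -scalerN.
Qed.

Lemma dplus_approx x e eps : Omega° x -> 0 < eps -> exists2 h0, 0 < h0 &
  forall h, 0 < h <= h0 -> Omega° (x + h *: e) /\
    dplus u e x <= diffq u e h x < dplus u e x + eps.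
Proof.
move=> Ox eps0; have O'x := interior_subset Ox.
have [_ [h1 [h10 Oh1] <-] h1lt] : exists2 r,
    [set diffq u e h x | h in [set h | 0 < h /\ Omega (x + h *: e)]] r &
    r < dplus u e x + eps.
  apply: inf_adherent => //; split.
    by have [h h0 [_ Oh]] := interior_pos e Ox; exists (diffq u e h x), h.
  have [k k0 [_ Ok]] := interior_pos (- e) Ox; rewrite scalerN in Ok.
  by exists (- diffq u (- e) k x); apply: dplus_lbound.
have [h2 h20 Hh2] := interior_ray e (nbhs_interior Ox).
exists (Num.min h1 h2); first by rewrite lt_min h10.
move=> h; rewrite le_min => /andP[h0 /andP[hh1 hh2]].
have Oh : Omega° (x + h *: e) by apply: Hh2; rewrite ger0_norm // ltW.
split => //; rewrite dplus_le //=; last exact: interior_subset.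
by apply: le_lt_trans h1lt; apply: (diffq_mono u_convex) => //; rewrite h0.
Qed.

Lemma dplus_cvg x e : Omega° x ->
  diffq u e k.+1%:R^-1 x @[k --> \oo] --> dplus u e x.
Proof.
move=> Ox; apply/cvgrPdist_lt => eps eps0.
have [h0 h00 H] := dplus_approx e Ox eps0.
have := near_infty_natSinv_lt (PosNum h00); apply: filterS => k /= kh.
have [|_ /andP[]] := H k.+1%:R^-1; first by rewrite ltW // invr_gt0 ltr0n.
by move=> dl du; rewrite ler0_norm ?subr_le0 // opprB ltrBlDl.
Qed.

(** Both derivatives are compared with the slope of the chord from x to x + t
    e.  Hence an open interval between the left and the right derivative at x
    does not meet the one at x + t e. *)
Lemma dplus_strict x e t : Omega° x -> Omega° (x + t *: e) -> 0 < t ->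
  dplus u e x + dplus u (- e) (x + t *: e) <= 0.
Proof.
move=> Ox Ot t0.
have H1 : dplus u e x <= diffq u e t x.
  by apply: dplus_le => //; exact: interior_subset.
have H2 : dplus u (- e) (x + t *: e) <= diffq u (- e) t (x + t *: e).
  by apply: dplus_le => //; rewrite scalerN addrK; exact: interior_subset.
have : diffq u e t x + diffq u (- e) t (x + t *: e) = 0.
  by rewrite /diffq scalerN addrK -mulrDl [X in X / _](_ : _ = 0) ?mul0r //; ring.
lra.
Qed.

Hypothesis u_bounded : forall x, Omega x -> -1 <= u x <= 0.

Lemma diffq_bound x e h : Omega x -> Omega (x + h *: e) -> 0 < h ->
  diffq u e h x <= h^-1.
Proof.
move=> /u_bounded ? /u_bounded ? h0; rewrite /diffq ler_pdivrMr // mulVf ?gt_eqF //.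
lra.
Qed.

Lemma dplus_bound x e h : Omega° x -> 0 < h -> Omega (x + h *: e) ->
  Omega (x - h *: e) -> `|dplus u e x| <= h^-1.
Proof.
move=> Ox h0 Op Om; have O'x := interior_subset Ox.
rewrite ler_norml; apply/andP; split.
  apply: le_trans (dplus_ge Ox h0 Om); rewrite lerN2 diffq_bound //.
  by rewrite scalerN.
by apply: le_trans (dplus_le Ox h0 Op) _; exact: diffq_bound.
Qed.

(** Stretch the segment from x to y until its length is r: the slope of the
    longer chord bounds the slope of the shorter one, and it is at most 1/r
    because u varies by at most 1.  The bound does not depend on u. *)
Lemma convex_lipschitz x y r : 0 < r -> (forall z, `|z - x| <= r -> Omega z) ->
  `|y - x| <= r -> `|u y - u x| <= `|y - x| / r.
Proof.
move=> r0 xr yr.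
have [->|yx] := eqVneq y x; first by rewrite !subrr !normr0 mul0r.
have d0 : 0 < `|y - x| by rewrite normr_gt0 subr_eq0.
set d := `|y - x| in yr d0 *.
pose e := y - x; pose k := r / d.
have k0 : 0 < k by rewrite divr_gt0.
have Ox : Omega x by apply: xr; rewrite subrr normr0 ltW.
have Oy : Omega y by exact: xr.
have Op : Omega (x + k *: e).
  by apply: xr; rewrite addrAC subrr add0r normrZ gtr0_norm // divfK ?gt_eqF.
have Om : Omega (x - k *: e).
  by apply: xr; rewrite addrAC subrr add0r normrN normrZ gtr0_norm // divfK ?gt_eqF.
have ye : x + 1 *: e = y by rewrite scale1r addrC subrK.
have uy : diffq u e 1 x = u y - u x by rewrite /diffq ye divr1.
rewrite ler_norml -uy; apply/andP; split.
  rewrite -subr_ge0 opprK; apply: le_trans (diffq_opp u_convex _ Om ltr01 k0) _.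
    by rewrite ye.
  rewrite lerD2l (le_trans (diffq_bound _ _ _)) ?scalerN //.
  by rewrite invfM invrK mulrC.
apply: le_trans (@diffq_mono _ _ _ u u_convex x e 1 k Ox Op _) _.
  by rewrite ltr01 /= ler_pdivlMr // mul1r.
by rewrite (le_trans (diffq_bound _ _ _)) // invfM invrK mulrC.
Qed.

Lemma convex_continuous x : Omega° x -> {for x, continuous u}.
Proof.
move=> /nbhs_ballP [r /= r0 rO].
have r20 : 0 < r / 2 by rewrite divr_gt0.
have rO2 z : `|z - x| <= r / 2 -> Omega z.
  move=> zx; apply: rO; rewrite -ball_normE /ball_/= distrC (le_lt_trans zx) //.
  by rewrite ltr_pdivrMr // ltr_pMr // ltr1n.
apply/cvgrPdist_lt => eps eps0.
apply/nbhs_ballP; exists (Num.min (r / 2) (eps * (r / 2))) => /=.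
  by rewrite lt_min r20 mulr_gt0.
move=> y; rewrite -ball_normE /ball_/= lt_min => /andP[yr ye].
rewrite distrC (le_lt_trans (convex_lipschitz r20 rO2 _)) ?ltr_pdivrMr //.
  by rewrite distrC ltW.
by rewrite distrC.
Qed.

End function.

(** An infimum of difference quotients, each of which converges, is upper
    semicontinuous in f.  Applied to e and to - e this gives a limsup and a
    liminf bound, and the hypothesis on w makes them equal. *)
Lemma dplus_limit (f : nat -> V -> R) (w : V -> R) x e :
  (forall j, convex_function (Omega : set (convex_lmodType V)) (f j)) ->
  convex_function (Omega : set (convex_lmodType V)) w ->
  (forall y, Omega° y -> f j y @[j --> \oo] --> w y) ->
  Omega° x -> dplus w e x + dplus w (- e) x = 0 ->
  dplus (f j) e x @[j --> \oo] --> dplus w e x.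
Proof.
move=> fc wc fw Ox we.
have upper e' eps : 0 < eps ->
    \forall j \near \oo, dplus (f j) e' x < dplus w e' x + eps.
  move=> eps0; have [h0 h00 /(_ h0)] := dplus_approx wc e' Ox eps0.
  rewrite h00 lexx => -[//|Oh /andP[_ Hh]].
  have cq : diffq (f j) e' h0 x @[j --> \oo] --> diffq w e' h0 x.
    by apply: cvgM; [exact: (cvgB (fw _ Oh) (fw _ Ox))|exact: cvg_cst].
  have [N _ C] := cvgr_lt _ cq _ Hh.
  exists N => // j Nj; apply: le_lt_trans (C j Nj).
  by apply: dplus_le => //; exact: interior_subset.
apply/cvgrPdist_lt => eps eps0.
have H1 := upper e eps eps0; have H2 := upper (- e) eps eps0.
apply: filterS2 H1 H2 => k H1 H2.
have := dplus_opp (fc k) e Ox.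
rewrite ltr_norml => H3; apply/andP; split; lra.
Qed.

End directional_derivative.

Section mean.
Context {R : realType} {V : lmodType R}.
Variables (Omega : set V) (Omega_convex : convex_set (Omega : set (convex_lmodType V))).
Variables (u : V -> R)
  (u_convex : convex_function (Omega : set (convex_lmodType V)) u).

(** Jensen's inequality with equal weights, for the passage from partial to
    total derivatives. *)
Lemma convex_mean m (y : nat -> V) : (forall i, Omega (y i)) ->
  Omega (m.+1%:R^-1 *: \sum_(i < m.+1) y i) /\
  u (m.+1%:R^-1 *: \sum_(i < m.+1) y i) <= m.+1%:R^-1 * \sum_(i < m.+1) u (y i).
Proof.
move=> Oy; elim: m => [|m [IO IH]].
  by rewrite !big_ord1 invr1 scale1r mul1r.
have m0 : (m.+1%:R : R) != 0 by rewrite pnatr_eq0.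
have m1 : (m.+2%:R : R) != 0 by rewrite pnatr_eq0.
pose t : R := m.+1%:R / m.+2%:R.
have t01 : 0 <= t <= 1 by rewrite div_itv01 ?ltr0n // ler0n /= ler_nat.
have t1 : 1 - t = m.+2%:R^-1.
  rewrite /t -{1}(divff m1) -mulrBl [in m.+2%:R - _]mulrSr.
  by rewrite addrAC subrr add0r mul1r.
have tm : t / m.+1%:R = m.+2%:R^-1.
  by rewrite /t mulrAC divff // mul1r.
have E : m.+2%:R^-1 *: \sum_(i < m.+2) y i =
    t *: (m.+1%:R^-1 *: \sum_(i < m.+1) y i) + (1 - t) *: y m.+1.
  by rewrite big_ord_recr /= scalerDr t1 scalerA tm.
rewrite E; split; first exact: convex_setP.
apply: le_trans (convex_functionP u_convex IO (Oy _) t01) _.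
rewrite [X in _ <= _ * X]big_ord_recr /= mulrDr t1 lerD2r.
rewrite [leRHS](_ : _ = t * (m.+1%:R^-1 * \sum_(i < m.+1) u (y i))); last first.
  by rewrite mulrA tm.
rewrite ler_wpM2l //.
by case/andP: t01.
Qed.

End mean.

Section pairing.
Context {R : realType} {n : nat}.
Local Notation Rn := 'rV[R]_n.

(** The candidate differential, as a bundled linear map. *)
Definition pairing (g h : Rn) : R := \sum_i g ord0 i * h ord0 i.

Lemma pairing_is_linear g : linear (pairing g).
Proof.
move=> a x y; rewrite /pairing scaler_sumr -big_split; apply: eq_bigr => i _.
by rewrite !mxE /= mulrDr mulrCA.
Qed.

HB.instance Definition _ g :=
  GRing.isLinear.Build R Rn R _ (pairing g) (pairing_is_linear g).

Lemma pairing_continuous g : continuous (pairing g).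
Proof.
apply: (@continuous_big _ _ _ _ xpredT add_continuous) => i _ x.
apply: (@continuous_comp _ _ _ (fun v : Rn => v ord0 i) ( *%R (g ord0 i))).
  exact: coord_continuous.
exact: mulrl_continuous.
Qed.

End pairing.

Section gradient.
Context {R : realType} {n : nat}.
Local Notation Rn := 'rV[R]_n.
Variables (Omega : set Rn) (Omega_convex : convex_set (Omega : set (convex_lmodType Rn))).
Variables (u : Rn -> R)
  (u_convex : convex_function (Omega : set (convex_lmodType Rn)) u).
Local Notation e_ i := (delta_mx ord0 i : Rn).

Lemma dplus_derive x v : Omega° x -> derivable u x v -> dplus Omega u v x = 'D_v u x.
Proof.
move=> Ox du.
rewrite -(cvg_lim (@Rhausdorff R) (dplus_cvg (e := v) u_convex Ox)).
apply: cvg_lim => //.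
have s0 : k.+1%:R^-1 @[k --> \oo] --> (0 : R)^'.
  move=> A /nbhs_ballP [r /= r0 rA].
  have [N _ HN] := near_infty_natSinv_lt (PosNum r0).
  exists N => // k Nk; apply: rA; last by rewrite invr_eq0 pnatr_eq0.
  rewrite /ball /= sub0r normrN ger0_norm ?invr_ge0 ?ler0n //; exact: HN.
have := cvg_comp _ _ s0 du; apply: cvg_trans; apply: near_eq_cvg.
by apply: nearW => k /=; rewrite /diffq mulrC [_ *: v + x]addrC.
Qed.

Lemma differentiable_dplus x v : Omega° x -> differentiable u x ->
  dplus Omega u v x + dplus Omega u (- v) x = 0.
Proof.
move=> Ox du; rewrite !dplus_derive //; try exact: diff_derivable.
by rewrite !deriveE // linearN subrr.
Qed.

(** For a convex function, two-sided partial derivatives imply total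
    differentiability. Subtract the linear part. Jensen on the n axis
    directions bounds the remainder from above by eps |h|; the bound from
    below follows from the one at - h, because u x is at most the mean of u (x
    + h) and u (x - h). *)
Lemma dplus_differentiable x : Omega° x ->
  (forall i, dplus Omega u (e_ i) x + dplus Omega u (- e_ i) x = 0) ->
  differentiable u x.
Proof.
move=> Ox ue; pose g : Rn := \row_i dplus Omega u (e_ i) x.
have O'x := interior_subset Ox.
have axis eps i : 0 < eps -> \forall t \near (0 : R),
    Omega (x + t *: e_ i) /\ u (x + t *: e_ i) - u x <= t * g ord0 i + eps * `|t|.
  move=> eps0; rewrite mxE.
  have [h1 h10 H1] := dplus_approx u_convex (e_ i) Ox eps0.
  have [h2 h20 H2] := dplus_approx u_convex (- e_ i) Ox eps0.
  apply/nbhs_ballP; exists (Num.min h1 h2) => /=; first by rewrite lt_min h10.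
  move=> t; rewrite /ball /= sub0r normrN lt_min => /andP[t1 t2].
  have [t0|t0|->] := ltgtP t 0; last first.
  - by rewrite scale0r addr0 subrr mul0r normr0 mulr0 addr0.
  - move: t1; rewrite gtr0_norm // => t1.
    have [|Oh /andP[_]] := H1 t; first by rewrite t0 ltW.
    rewrite /diffq ltr_pdivrMr // => Hd.
    split; [exact: interior_subset|].
    by rewrite (le_trans (ltW Hd)) // mulrDl mulrC.
  - move: t2; rewrite ltr0_norm // => t2.
    have nt0 : 0 < - t by rewrite oppr_gt0.
    have [|Oh /andP[_]] := H2 (- t); first by rewrite nt0 ltW.
    rewrite /diffq ltr_pdivrMr // scalerN scaleNr opprK => Hd.
    split; first by rewrite -[t]opprK scaleNr -scalerN; exact: interior_subset.
    rewrite (le_trans (ltW Hd)) //.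
    have -> : dplus Omega u (- e_ i) x = - dplus Omega u (e_ i) x.
      by apply/eqP; rewrite -addr_eq0 addrC ue.
    by rewrite mulrDl mulrNN mulrC.
have upper eps : 0 < eps -> exists2 r, 0 < r & forall h : Rn, `|h| <= r ->
    Omega (x + h) /\ u (x + h) - u x <= pairing g h + eps * `|h|.
  move=> eps0.
  have eps1 : 0 < eps / n.+1%:R by rewrite divr_gt0.
  have /nbhs_ballP[r0 /= r00 Hr] : \forall t \near (0 : R), forall i,
      Omega (x + t *: e_ i) /\
      u (x + t *: e_ i) - u x <= t * g ord0 i + eps / n.+1%:R * `|t|.
    by apply: (@filter_forall _ _ _ _ (nbhs_filter (0 : R))) => i; exact: axis.
  have n1 : 0 < n.+1%:R :> R by rewrite ltr0n.
  exists (r0 / 2 / n.+1%:R); first by rewrite !divr_gt0.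
  move=> h hr.
  (* The extra point x among the n + 1 averaged points makes the argument
     uniform in n, including n = 0. *)
  pose y (k : nat) : Rn :=
    if insub k is Some i then x + (n.+1%:R * h ord0 i) *: e_ i else x.
  have small i : ball (0 : R) r0 (n.+1%:R * h ord0 i).
    rewrite /ball /= sub0r normrN normrM gtr0_norm // -ltr_pdivlMl //.
    rewrite (le_lt_trans (rV_coord_le_norm h i)) // (le_lt_trans hr) // mulrC.
    by rewrite ltr_pM2l ?invr_gt0 // ltr_pdivrMr // ltr_pMr // ltr1n.
  have Oy k : Omega (y k).
    by rewrite /y; case: insub => // i; have [] := Hr _ (small i) i.
  have [] := convex_mean Omega_convex u_convex n Oy.
  have -> : n.+1%:R^-1 *: \sum_(i < n.+1) y i = x + h.
    rewrite big_ord_recr /= {2}/y insubF ?ltnn //.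
    under eq_bigr => i _ do rewrite /y /= (valK i) -scalerA.
    rewrite big_split /= sumr_const card_ord -scaler_sumr addrAC.
    rewrite -mulrSr -[x *+ _]scaler_nat -scalerDr scalerA mulVf ?gt_eqF // scale1r.
    by rewrite -row_sum_delta.
  move=> Oxh; rewrite big_ord_recr /= [X in _ * (_ + u X)]/y insubF ?ltnn //.
  under eq_bigr => i _ do rewrite /y /= (valK i).
  move=> uxh; split => //.
  have S : \sum_(i < n) u (x + (n.+1%:R * h ord0 i) *: e_ i) <=
      \sum_(i < n) (u x + n.+1%:R * (g ord0 i * h ord0 i) + eps * `|h|).
    apply: ler_sum => i _; have [_] := Hr _ (small i) i.
    rewrite lerBlDl => /le_trans; apply; rewrite -addrA lerD2l lerD //.
      by rewrite mulrAC -mulrA.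
    rewrite normrM gtr0_norm // mulrA divfK ?gt_eqF //.
    by rewrite ler_wpM2l ?rV_coord_le_norm // ltW.
  rewrite lerBlDr (le_trans uxh) // ler_pdivrMl // (le_trans (lerD S (lexx _))) //.
  rewrite !big_split /= -mulr_sumr -/(pairing g h) !sumr_const card_ord.
  rewrite -[n.+1%:R]natr1 -[u x *+ n]mulr_natl -[(eps * `|h|) *+ n]mulr_natl.
  have eh : 0 <= eps * `|h| by rewrite mulr_ge0 // ltW.
  move: (pairing g h) (eps * `|h|) eh (n%:R : R) (u x) => p q q0 m v; nra.
have E : (u : Rn -> R^o) \o shift x = cst (u x) + (pairing g : Rn -> R^o) +o_ (0 : Rn) id.
  apply/eqaddoP => _/posnumP[eps].
  have [r r0 Hr] := upper eps%:num [gt0 of eps%:num].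
  apply/nbhs_ballP; exists r => //= h; rewrite -ball_normE /ball_/= sub0r normrN => hr.
  have [Op Hp] := Hr h (ltW hr).
  have [Om Hm] : Omega (x - h) /\ u (x - h) - u x <= pairing g (- h) + eps%:num * `|- h|.
    by apply: Hr; rewrite normrN ltW.
  rewrite normrN linearN in Hm.
  have t01 : 0 <= (2^-1 : R) <= 1 by lra.
  have := convex_functionP u_convex Op Om t01.
  have -> : 2^-1 *: (x + h) + (1 - 2^-1) *: (x - h) = x.
    have -> : 1 - 2^-1 = 2^-1 :> R by lra.
    rewrite -scalerDr addrACA subrr addr0 -mulr2n -[x *+ 2]scaler_nat scalerA.
    by rewrite mulVf ?scale1r.
  move=> Hc.
  rewrite -![(_ + _ : _ -> _) _]/(_ + _) -![(- _ : _ -> _) _]/(- _) /cst /=.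
  rewrite -![(_ + _ : _ -> _) _]/(_ + _) [h + x]addrC opprD addrA.
  rewrite ler_norml; apply/andP; split; lra.
have gc : continuous (pairing g : Rn -> R^o) by exact: pairing_continuous.
by apply/diff_locallyP; rewrite (diff_unique gc E).
Qed.

End gradient.

(** * Almost everywhere differentiability *)

Lemma negligible_countable_bigcup d (T : measurableType d) (R : realType)
    (mu : {measure set T -> \bar R}) (I : countType) (F : I -> set T) :
  (forall i, mu.-negligible (F i)) -> mu.-negligible (\bigcup_i F i).
Proof.
move=> nF; pose G k := if unpickle k is Some i then F i else set0.
apply: (@negligibleS _ _ _ _ (\bigcup_k G k)).
  by move=> x [i _ Fx]; exists (pickle i) => //; rewrite /G pickleK.
apply: negligible_bigcup => k; rewrite /G; case: unpickle => // .
exact: negligible_set0.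
Qed.

Section boundary.
Context {R : realType} {n : nat}.
Local Notation Rn := 'rV[R]_n.
Local Notation mu := (lebesgue_rV n).
Variables (Omega : set Rn) (Omega_compact : compact Omega).

Lemma compact_norm_bound : exists2 B : R, 0 < B & forall x, Omega x -> `|x| <= B.
Proof.
have [M [_ HM]] := compact_bounded Omega_compact.
exists (Num.max M 0 + 1); first by rewrite ltr_wpDl // le_max lexx orbT.
by move=> x; apply: HM; rewrite ltr_pwDr // le_max lexx.
Qed.

Lemma compact_measurable_rV : measurable Omega.
Proof. exact: closed_measurable_rV (compact_closed (@norm_hausdorff _ _) Omega_compact). Qed.

Lemma interior_measurable_rV : measurable Omega°.
Proof. exact: open_measurable_rV (open_interior _). Qed.

Lemma compact_lebesgue_lty : (mu Omega < +oo)%E.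
Proof.
have [B _ HB] := compact_norm_bound.
exact: lebesgue_rV_bounded_lty compact_measurable_rV HB.
Qed.

(** The point y + s d is within s r of s x0 + (1 - s) y, and the ball of
    radius s r around the latter lies in Omega by convexity. *)
Lemma convex_interior_ray x0 r y d s :
  convex_set (Omega : set (convex_lmodType Rn)) ->
  ball x0 r `<=` Omega -> Omega y -> ball x0 r (y + d) -> 0 < s <= 1 ->
  Omega° (y + s *: d).
Proof.
move=> cO rO Oy yd /andP[s0 s1].
pose c := s *: x0 + (1 - s) *: y.
have cb : ball c (s * r) `<=` Omega.
  move=> z; rewrite -ball_normE /ball_/= => cz.
  pose z' := s^-1 *: (z - (1 - s) *: y).
  have -> : z = s *: z' + (1 - s) *: y.
    by rewrite /z' scalerA divff ?gt_eqF // scale1r subrK.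
  apply: convex_setP => //; last by rewrite (ltW s0).
  apply: rO; rewrite -ball_normE /ball_/=.
  have -> : x0 - z' = s^-1 *: (c - z).
    rewrite /z' -[x0 in LHS](scalerK (lt0r_neq0 s0)) -scalerBr.
    by rewrite /c opprB addrA.
  by rewrite normrZ gtr0_norm ?invr_gt0 // -ltr_pdivlMl ?invr_gt0 // invrK.
have : ball c (s * r) (y + s *: d).
  move: yd; rewrite -!ball_normE /ball_/=.
  have -> : c - (y + s *: d) = s *: (x0 - (y + d)).
    rewrite /c scalerBl scale1r scalerBr scalerDr !opprD !addrA.
    by rewrite (addrAC (s *: x0 + y)) addrK.
  by rewrite normrZ gtr0_norm // ltr_pM2l.
have oc : open (ball c (s * r)) by exact: ball_open.
by move=> bc; apply: filterS (open_nbhs_nbhs (conj oc bc)).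
Qed.

(** A boundary point y is sent into the interior by s d, 0 < s <= 1, for every
    d close to x0 - y.  Countably many rational d suffice, and for each of
    them the corresponding piece of the boundary is disjoint from its
    translates. *)
Lemma boundary_negligible : convex_set (Omega : set (convex_lmodType Rn)) ->
  Omega° !=set0 -> mu.-negligible (Omega `\` Omega°).
Proof.
move=> cO [x0 /nbhs_ballP[r /= r0 rO]].
have [B B0 HB] := compact_norm_bound.
pose N (c : 'rV[rat]_n) := (Omega `\` Omega°) `&` ball (x0 - map_mx ratr c) r.
apply: (@negligibleS _ _ _ _ (\bigcup_c N c)).
  move=> y [Oy nOy].
  have [c [m [_ cb]]] := rational_ball (nbhsx_ballx (x0 - y) r r0).
  exists c => //; split => //.
  have m0 : 0 < m.+1%:R^-1 *+ 2 :> R by rewrite mulrn_wgt0 // invr_gt0.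
  have := cb _ (ballxx _ m0); rewrite -!ball_normE /ball_/=.
  by rewrite addrAC.
apply: negligible_countable_bigcup => c.
have mN : measurable (N c).
  apply: measurableI; last exact: measurable_rV_ball.
  by apply: measurableD; [exact: compact_measurable_rV|exact: interior_measurable_rV].
apply/negligibleP => //; apply: (@null_disjoint_shifts _ _ _ (map_mx ratr c) B) => //.
  by move=> x [[Ox _] _]; exact: HB.
move=> s x s01 [[Ox _] xb] [[_ nO] _]; apply: nO.
apply: convex_interior_ray rO Ox _ s01 => //.
by move: xb; rewrite -!ball_normE /ball_/= opprD addrA addrAC.
Qed.

End boundary.

Section measurability.
Context {R : realType} {n : nat}.
Local Notation Rn := 'rV[R]_n.
Local Notation mu := (lebesgue_rV n).
Local Notation e_ i := (delta_mx ord0 i : Rn).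
Variables (Omega : set Rn) (Omega_compact : compact Omega)
  (Omega_convex : convex_set (Omega : set (convex_lmodType Rn))).
Variables (u : Rn -> R) (Cu : Chat Omega u).

Let u_convex : convex_function (Omega : set (convex_lmodType Rn)) u.
Proof. by have [] := Cu. Qed.

Let u_bounded x : Omega x -> -1 <= u x <= 0.
Proof. by have [+ _ _] := Cu; apply. Qed.

Lemma Chat_measurable : measurable_fun Omega° u.
Proof.
apply: continuous_measurable_rV; first exact: open_interior.
by move=> x Ox; exact: convex_continuous u_convex u_bounded _ Ox.
Qed.

(** A pointwise limit of difference quotients. Extending u by 0 outside the
    interior makes these quotients measurable on the whole space without
    changing the limit. *)
Lemma dplus_measurable e : measurable_fun Omega° (dplus Omega u e).
Proof.
pose v := u \_ Omega°.
have mv : measurable_fun setT v.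
  apply/(measurable_restrictT _ _).1; last exact: Chat_measurable.
  exact: interior_measurable_rV.
apply: (@measurable_fun_cvg _ _ _ _ (fun k => diffq v e k.+1%:R^-1)).
  move=> k; apply: measurable_funTS; apply: measurable_funM => //.
  apply: measurable_funB => //.
  exact: measurableT_comp mv (measurable_rV_shift _).
move=> x Ox; apply: cvg_trans (dplus_cvg (e := e) u_convex Ox).
apply: near_eq_cvg.
have [h h0 H] := interior_ray e (nbhs_interior Ox).
have [N _ HN] := near_infty_natSinv_lt (PosNum h0).
exists N => // k Nk; rewrite /diffq /v !patchE !mem_set //.
by apply: H; rewrite ger0_norm ?invr_ge0 ?ler0n //; exact: ltW (HN k Nk).
Qed.

(** For convex u these are the interior points of differentiability
    (smooth_pointsP); in this form measurability is visible. *)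
Definition smooth_points :=
  [set x | Omega° x /\ forall i, dplus Omega u (e_ i) x + dplus Omega u (- e_ i) x = 0].

Lemma smooth_pointsP x : smooth_points x <-> Omega° x /\ differentiable u x.
Proof.
split=> -[Ox ux]; split => //; first exact: (dplus_differentiable Omega_convex u_convex).
by move=> i; exact: (differentiable_dplus u_convex).
Qed.

Lemma smooth_points_measurable : measurable smooth_points.
Proof.
rewrite (_ : smooth_points = Omega° `&` \bigcap_(i in [set: 'I_n])
   (Omega° `&` (fun x => dplus Omega u (e_ i) x + dplus Omega u (- e_ i) x) @^-1` [set 0])).
  have mO : measurable (Omega°) by exact: interior_measurable_rV.
  apply: measurableI => //; apply: fin_bigcap_measurable => [|i _]; first exact: finite_finset.
  apply: measurable_funD => //; exact: dplus_measurable.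
by apply/seteqP; split => x [Ox H]; split => // i; [split => //; exact: H|
  have [] := H i I].
Qed.

(** The classical gradient is thus a measurable function and not merely almost
    everywhere equal to one, so the energies are integrals of measurable
    functions. *)
Lemma gradientE x : gradient Omega u x =
  \row_i ((dplus Omega u (e_ i)) \_ smooth_points) x.
Proof.
apply/rowP => i; rewrite /gradient mxE patchE; case: asboolP => [H|H].
  have [Ox du] := H; rewrite mem_set ?mxE; last exact/smooth_pointsP.
  by rewrite dplus_derive //; exact: diff_derivable.
by rewrite mxE memNset // => /smooth_pointsP.
Qed.

Lemma gradient_measurable i : measurable_fun setT (fun x => gradient Omega u x ord0 i).
Proof.
under eq_fun do rewrite gradientE mxE.
apply/(measurable_restrictT _ _).1; first exact: smooth_points_measurable.
by apply: measurable_funS (dplus_measurable _) => [|x []//];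
  exact: interior_measurable_rV.
Qed.

Lemma sqnorm_gradient_measurable :
  measurable_fun setT (fun x => sqnorm (gradient Omega u x)).
Proof.
apply: measurable_sum => i; apply: measurable_funX; exact: gradient_measurable.
Qed.

(** A point of the interior where u is not differentiable has, for some axis
    e, a rational number strictly between the left and right derivatives.  For
    a fixed axis and a fixed rational, dplus_strict makes this set disjoint
    from its translates along e. *)
Lemma ae_smooth_points : Omega° !=set0 ->
  {ae mu, forall x, Omega x -> smooth_points x}.
Proof.
move=> O0.
have [B B0 HB] := compact_norm_bound Omega_compact.
pose N (k : 'I_n * rat) := Omega° `&`
  [set x | - dplus Omega u (- e_ k.1) x < ratr k.2 /\ ratr k.2 < dplus Omega u (e_ k.1) x].
apply: (@negligibleS _ _ _ _ ((Omega `\` Omega°) `|` \bigcup_k N k)).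
  move=> x /= /not_implyP[Ox nD].
  have [iOx|nOx] := pselect (Omega° x); last by left.
  right; have [i Hi] : exists i, ~ (dplus Omega u (e_ i) x + dplus Omega u (- e_ i) x = 0).
    by apply/existsNP => H; apply: nD.
  have : - dplus Omega u (- e_ i) x < dplus Omega u (e_ i) x.
    rewrite -subr_gt0 opprK lt_neqAle eq_sym; apply/andP; split; first exact/eqP.
    exact: dplus_opp.
  move=> /rat_in_itvoo [q]; rewrite in_itv/= => /andP[q1 q2].
  by exists (i, q).
apply: negligibleU; first exact: boundary_negligible.
apply: negligible_countable_bigcup => -[i q].
have mO : measurable (Omega°) by exact: interior_measurable_rV.
have mN : measurable (N (i, q)).
  rewrite (_ : N _ = (Omega° `&` (fun x => - dplus Omega u (- e_ i) x) @^-1` `]-oo, ratr q[)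
     `&` (Omega° `&` dplus Omega u (e_ i) @^-1` `]ratr q, +oo[)).
    apply: measurableI.
      by apply: measurableT_comp => //; exact: dplus_measurable.
    exact: dplus_measurable.
  apply/seteqP; split => x; rewrite /N /= !in_itv/= andbT; tauto.
apply/negligibleP => //; apply: (@null_disjoint_shifts _ _ _ (e_ i) B) => //.
  by move=> x [/interior_subset Ox _]; exact: HB.
move=> s x /andP[s0 _] [Ox [_ q1]] [Os [q2 _]].
have := dplus_strict u_convex Ox Os s0; move: q1 q2 => /=; lra.
Qed.

End measurability.

(** * Sequential compactness of the convex class *)

Lemma conv_lt {R : realFieldType} (s r p q : R) : 0 <= s <= 1 ->
  p < r -> q < r -> s * p + (1 - s) * q < r.
Proof.
move=> /andP[s0 s1] pr qr; apply: (@le_lt_trans _ _ (Num.max p q)).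
  have -> : Num.max p q = s * Num.max p q + (1 - s) * Num.max p q by ring.
  by rewrite lerD // ler_wpM2l ?subr_ge0 // le_max lexx ?orbT.
by rewrite gt_max pr.
Qed.

(** Bounds a convex combination of near-optimal values when the slack is the
    distance from a to the combination of the optimal ones. *)
Lemma conv_lt_bound {R : realFieldType} (s a p q P Q : R) : 0 <= s <= 1 ->
  p < P + (a - (s * P + (1 - s) * Q)) -> q < Q + (a - (s * P + (1 - s) * Q)) ->
  s * p + (1 - s) * q <= a.
Proof.
set d := a - _ => /andP[s0 s1] pP qQ.
have -> : a = s * (P + d) + (1 - s) * (Q + d) by rewrite /d; ring.
by rewrite lerD // ler_wpM2l ?subr_ge0 // ltW.
Qed.

Section lsc_envelope.
Context {R : realType} {n : nat}.
Local Notation Rn := 'rV[R]_n.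
Variables (Omega : set Rn) (Omega_convex : convex_set (Omega : set (convex_lmodType Rn))).
Variables (W : Rn -> R)
  (W_convex : convex_function (Omega : set (convex_lmodType Rn)) W).
Hypothesis W_bounded : forall x, Omega x -> -1 <= W x <= 0.

Let m x r := inf [set W y | y in ball x r `&` Omega].

(** The supremum over radii of the infima over balls: the largest lower
    semicontinuous function on Omega below W. *)
Definition lsc_envelope x := sup [set m x r | r in [set r | 0 < r]].

Let w := lsc_envelope.

Let m_le x r y : Omega y -> ball x r y -> m x r <= W y.
Proof.
move=> Oy xy; apply: ge_inf; last by exists y.
by exists (-1) => _ [z [_ Oz] <-]; have /andP[] := W_bounded Oz.
Qed.

Let m_le0 x r : Omega x -> 0 < r -> m x r <= 0.
Proof.
move=> Ox r0; apply: (le_trans (m_le Ox (ballxx _ r0))).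
by have /andP[] := W_bounded Ox.
Qed.

Let m_has_sup x : Omega x -> has_sup [set m x r | r in [set r | 0 < r]].
Proof.
move=> Ox; split; first by exists (m x 1), 1 => //=.
by exists 0 => _ [r /= r0 <-]; exact: m_le0.
Qed.

Let env_ge x r a : Omega x -> 0 < r ->
  (forall y, Omega y -> ball x r y -> a <= W y) -> a <= w x.
Proof.
move=> Ox r0 H; apply: (@le_trans _ _ (m x r)).
  apply: lb_le_inf; first by exists (W x), x => //; split => //; exact: ballxx.
  by move=> _ [y [xy Oy] <-]; exact: H.
by apply: ub_le_sup; [exact: (m_has_sup Ox).2|exists r].
Qed.

Let env_lt x a : Omega x -> a < w x ->
  exists2 r, 0 < r & forall y, Omega y -> ball x r y -> a < W y.
Proof.
move=> Ox aw; have aw0 : 0 < w x - a by rewrite subr_gt0.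
have [_ [r /= r0 <-] Hr] := sup_adherent aw0 (m_has_sup Ox).
exists r => // y Oy xy; apply: lt_le_trans (m_le Oy xy).
by move: Hr; rewrite -/(lsc_envelope x) -/w opprB addrC subrK.
Qed.

Let env_le x : Omega x -> w x <= W x.
Proof.
move=> Ox; rewrite leNgt; apply/negP => /(env_lt Ox)[r r0 /(_ x Ox)].
by rewrite ltxx => H; exfalso; move: (H (ballxx _ r0)).
Qed.

Let env_approx x r eps : Omega x -> 0 < r -> 0 < eps ->
  exists y, [/\ Omega y, ball x r y & W y < w x + eps].
Proof.
move=> Ox r0 eps0; apply: contrapT => H.
suff : w x + eps <= w x by rewrite gerDl leNgt eps0.
apply: env_ge Ox r0 _ => y Oy xy; rewrite leNgt; apply/negP => yw.
by apply: H; exists y.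
Qed.

(** Convexity: near-optimal points around x and around y are averaged into a
    point near the average, where convexity of W applies.  Outside Omega the
    subspace topology is discrete, so semicontinuity is automatic there. *)
Lemma lsc_envelope_Chat : Chat Omega w.
Proof.
split.
- move=> x Ox; apply/andP; split.
    by apply: env_ge Ox ltr01 _ => y /W_bounded /andP[].
  by apply: le_trans (env_le Ox) _; have /andP[] := W_bounded Ox.
- move=> t x y /set_mem Ox /set_mem Oy.
  have t01 : 0 <= t%:num <= 1 by apply/andP; split; [exact: ge0|exact: le1].
  set z := conv t x y.
  have zE : z = t%:num *: (x : Rn) + (1 - t%:num) *: (y : Rn) by [].
  have Oz : Omega z by rewrite zE; exact: convex_setP.
  rewrite leNgt; apply/negP.
  have -> : conv t (w x : R^o) (w y : R^o) = t%:num * w x + (1 - t%:num) * w y by [].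
  set c := _ + _ => cz.
  have ca : c < (w z + c) / 2 by lra.
  have az : (w z + c) / 2 < w z by lra.
  move: ca az; set a := _ / 2 => ca az.
  have [r r0 Hr] := env_lt Oz az.
  have ac0 : 0 < a - c by lra.
  have [x' [Ox' xx' Wx']] := env_approx Ox r0 ac0.
  have [y' [Oy' yy' Wy']] := env_approx Oy r0 ac0.
  have Oz' := convex_setP Omega_convex Ox' Oy' t01.
  have zz' : ball z r (t%:num *: x' + (1 - t%:num) *: y').
    move: xx' yy'; rewrite -!ball_normE /ball_/= => xx' yy'.
    rewrite zE opprD addrACA -!scalerBr.
    have /andP[t0 t1] := t01.
    apply: le_lt_trans (ler_normD _ _) _; rewrite !normrZ ger0_norm //.
    rewrite ger0_norm ?subr_ge0 //.
    exact: conv_lt t01 xx' yy'.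
  have := Hr _ Oz' zz'; rewrite ltNge => /negP; apply.
  apply: le_trans (convex_functionP W_convex Ox' Oy' t01) _.
  exact: (conv_lt_bound t01 Wx' Wy').
- move=> x a ax'; have ax : a < w x by rewrite -lte_fin.
  have [Ox|nOx] := pselect (Omega x); last first.
    exists [set x]; last by move=> _ ->; rewrite lte_fin.
    by case: (@nbhs_subspaceP _ Omega x) => // _ y.
  have aa : a < (w x + a) / 2 by lra.
  have aw : (w x + a) / 2 < w x by lra.
  have [r r0 Hr] := env_lt Ox aw.
  exists [set y | a < w y]; last by move=> y /=; rewrite lte_fin.
  case: (@nbhs_subspaceP _ Omega x) => // _; apply/nbhs_ballP; exists (r / 2) => /=.
    by rewrite divr_gt0.
  move=> y xy Oy /=; apply: lt_le_trans aa _.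
  apply: (@env_ge _ (r / 2)) => //; first by rewrite divr_gt0.
  by move=> z Oz yz; apply/ltW/Hr => //; exact: ball_split xy yz.
Qed.

Lemma lsc_envelope_interior x : Omega° x -> w x = W x.
Proof.
move=> Ox; have Ox' := interior_subset Ox.
apply/eqP; rewrite eq_le env_le //=; apply/ler_addgt0Pl => eps eps0.
have := convex_continuous W_convex W_bounded Ox.
move=> /cvgrPdist_lt /(_ _ eps0) /nbhs_ballP [r /= r0 Hr].
rewrite -lerBlDl; apply: (env_ge Ox' r0) => y Oy xy.
have := Hr y xy; rewrite ltr_norml => /andP[_]; lra.
Qed.

End lsc_envelope.
Section compactness.
Context {R : realType} {n : nat}.
Local Notation Rn := 'rV[R]_n.
Variables (Omega : set Rn) (Omega_convex : convex_set (Omega : set (convex_lmodType Rn))).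
Variables (f : nat -> Rn -> R) (Cf : forall k, Chat Omega (f k)).

(** Tychonoff's theorem for the product of copies of [-1, 0] over all points.
    Only the values at finitely many points and late indices are recorded,
    since a cluster point does not provide a subsequence converging
    everywhere. *)
Lemma pointwise_cluster : exists W : Rn -> R,
  (forall x, -1 <= W x <= 0) /\
  forall (xs : seq Rn) eps N, (forall x, x \in xs -> Omega x) -> 0 < eps ->
    exists2 k, (N <= k)%N & forall x, x \in xs -> `|f k x - W x| < eps.
Proof.
(* Values outside Omega are unconstrained, so they are replaced by 0 to stay
   in the compact product. *)
pose g k : Rn -> R := fun x => if `[< Omega x >] then f k x else 0.
pose K := [set h : prod_topology (fun _ : Rn => R) | forall x, `[-1, 0]%classic (h x)].
have cK : compact K by apply: (@tychonoff _ (fun _ : Rn => R) (fun _ => `[-1, 0]%classic)) => _;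
    exact: segment_compact.
have gK : (g @ \oo) K.
  exists 0%N => // k _ x /=; rewrite in_itv/= /g; case: asboolP => Ox; last first.
    by rewrite lexx lerN10.
  by have [+ _ _] := Cf k; apply.
have [W [WK clW]] := cK (g @ \oo) _ gK.
exists W; split=> [x|xs eps N xsO eps0]; first by have := WK x; rewrite /= in_itv.
pose B := [set h : prod_topology (fun _ : Rn => R) |
  forall x, x \in xs -> ball (W x) eps (h x)].
have nB : nbhs W B.
  rewrite /B; elim: xs {xsO B} => [|x xs IH].
    by apply: filterS filterT => h _ x.
  have nx : nbhs W (proj x @^-1` ball (W x) eps) :=
    @proj_continuous _ (fun _ : Rn => R) x W _ (nbhsx_ballx _ _ eps0).
  apply: filterS2 IH nx => h H1 H2 y; rewrite inE => /orP[/eqP -> //|]; exact: H1.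
have gN : (g @ \oo) [set g k | k in [set k | (N <= k)%N]].
  by exists N => // k Nk; exists k.
have [_ [[k Nk <-] Bk]] := clW _ _ gN nB.
exists k => // x xxs; have := Bk x xxs; rewrite -ball_normE /ball_/= distrC /g.
by case: asboolP => // nO; have := nO (xsO x xxs).
Qed.

Lemma Chat_cluster_convex W : (forall x, -1 <= W x <= 0) ->
  (forall (xs : seq Rn) eps N, (forall x, x \in xs -> Omega x) -> 0 < eps ->
    exists2 k, (N <= k)%N & forall x, x \in xs -> `|f k x - W x| < eps) ->
  convex_function (Omega : set (convex_lmodType Rn)) W.
Proof.
move=> W01 HW t x y /set_mem Ox /set_mem Oy.
have t01 : 0 <= t%:num <= 1 by apply/andP; split; [exact: ge0|exact: le1].
pose z : Rn := t%:num *: (x : Rn) + (1 - t%:num) *: (y : Rn).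
have Oz : Omega z by exact: convex_setP.
suff : W z <= t%:num * W x + (1 - t%:num) * W y by [].
apply/ler_addgt0Pl => eps eps0.
have e2 : 0 < eps / 2 by rewrite divr_gt0.
have [|k _ Hk] := HW [:: x : Rn; y : Rn; z] (eps / 2) 0%N _ e2.
  by move=> v; rewrite !inE => /or3P[] /eqP ->.
have [_ ck _] := Cf k.
have := convex_functionP ck Ox Oy t01; rewrite -/z => cz.
have := Hk x; rewrite inE eqxx => /(_ isT) Hx.
have := Hk y; rewrite !inE eqxx orbT => /(_ isT) Hy.
have := Hk z; rewrite !inE eqxx !orbT => /(_ isT) Hz.
move: Hx Hy Hz cz; rewrite !ltr_norml.
move: t01 (W z) (W x) (W y) (f k x) (f k y) (f k z).
move=> /andP[]; move: (t%:num : R) => s s0 s1 a b c a' b' c'.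
move=> /andP[? ?] /andP[? ?] /andP[? ?] ?.
have : s * (a' - b) <= s * (eps / 2) by rewrite ler_wpM2l // ltW.
have : (1 - s) * (b' - c) <= (1 - s) * (eps / 2) by rewrite ler_wpM2l ?subr_ge0 // ltW.
lra.
Qed.

(** Diagonal choice: the k-th index is good to within 1/(k+1) at the first k
    rational points.  Equi-Lipschitz continuity transfers the convergence from
    rational points to all interior points. *)
Lemma cluster_subsequence W : (forall x, -1 <= W x <= 0) ->
  (forall (xs : seq Rn) eps N, (forall x, x \in xs -> Omega x) -> 0 < eps ->
    exists2 k, (N <= k)%N & forall x, x \in xs -> `|f k x - W x| < eps) ->
  convex_function (Omega : set (convex_lmodType Rn)) W ->
  exists s : nat -> nat, {homo s : i j / (i < j)%N} /\
    forall x, Omega° x -> f (s k) x @[k --> \oo] --> W x.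
Proof.
move=> W01 HW cW.
pose d (j : nat) : Rn := if @unpickle 'rV[rat]_n j is Some c then map_mx ratr c else 0.
have /choice [F HF] : forall p : nat * nat, exists k, (p.2 <= k)%N /\
    forall j, (j < p.1)%N -> Omega (d j) -> `|f k (d j) - W (d j)| < p.1.+1%:R^-1.
  move=> [a b] /=.
  have [||k bk Hk] := HW [seq x <- [seq d j | j <- iota 0 a] | `[< Omega x >]] a.+1%:R^-1 b.
  - by move=> x; rewrite mem_filter => /andP[/asboolP].
  - by rewrite invr_gt0.
  exists k; split => // j ja Oj; apply: Hk.
  rewrite mem_filter; apply/andP; split; first exact/asboolP.
  by apply: map_f; rewrite mem_iota.
(* Starting the search at (s k).+1 makes s increasing. *)
pose s := fix s k := if k is k'.+1 then F (k, (s k').+1) else F (0%N, 0%N).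
have sS k : (s k < s k.+1)%N by have [] := HF (k.+1, (s k).+1).
have sd k j : (j < k)%N -> Omega (d j) -> `|f (s k) (d j) - W (d j)| < k.+1%:R^-1.
  by case: k => // k jk Oj; have [_] := HF (k.+1, (s k).+1); apply.
exists s; split; first by apply: homo_ltn => //; exact: ltn_trans.
move=> x Ox; have [r0 /= r00 rO] := (nbhs_ballP _ _).1 Ox.
pose r := r0 / 2; have r_gt0 : 0 < r by rewrite divr_gt0.
have rO' z : `|z - x| <= r -> Omega z.
  move=> zx; apply: rO; rewrite -ball_normE /ball_/= distrC (le_lt_trans zx) //.
  by rewrite ltr_pdivrMr // ltr_pMr // ltr1n.
apply/cvgrPdist_lt => eps eps0.
pose del := Num.min r (eps * r / 4).
have del0 : 0 < del by rewrite lt_min r_gt0 /= divr_gt0 // mulr_gt0.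
have [c [m [cx cA]]] := rational_ball (nbhsx_ballx x del del0).
have m0 : 0 < m.+1%:R^-1 *+ 2 :> R by rewrite mulrn_wgt0 // invr_gt0.
have {cx cA} := cA _ (ballxx _ m0); rewrite -ball_normE /ball_/= distrC => cx.
have [cr ce] : `|map_mx ratr c - x| <= r /\ `|map_mx ratr c - x| / r <= eps / 4.
  move: cx; rewrite lt_min => /andP[cr ce]; split; first exact: ltW.
  by rewrite ler_pdivrMr // mulrAC ltW.
have dc : d (pickle c) = map_mx ratr c by rewrite /d pickleK.
have Oc := rO' _ cr.
have lip (u : Rn -> R) : convex_function (Omega : set (convex_lmodType Rn)) u ->
    (forall x, Omega x -> -1 <= u x <= 0) -> `|u (map_mx ratr c) - u x| <= eps / 4.
  move=> cu bu; apply: le_trans ce.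
  exact: (convex_lipschitz cu bu r_gt0 rO' cr).
have e2 : 0 < eps / 2 by rewrite divr_gt0.
have [N _ HN] := near_infty_natSinv_lt (PosNum e2).
exists (maxn N (pickle c).+1) => // k /=; rewrite geq_max => /andP[Nk ck].
have /= H1 := HN k Nk.
have := sd k _ ck; rewrite dc => /(_ Oc) /lt_trans /(_ H1).
have [bk cvk _] := Cf (s k).
have := lip _ cvk bk; have := lip W cW (fun x _ => W01 x).
rewrite !ler_norml !ltr_norml => /andP[? ?] /andP[? ?] /andP[? ?].
by apply/andP; split; lra.
Qed.

(** The cluster point may fail to be lower semicontinuous on the boundary of
    Omega; its envelope repairs this without changing interior values. *)
Theorem Chat_sequentially_compact : exists (s : nat -> nat) (w : Rn -> R),
  [/\ {homo s : i j / (i < j)%N}, Chat Omega w &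
      forall x, Omega° x -> f (s k) x @[k --> \oo] --> w x].
Proof.
have [W [W01 HW]] := pointwise_cluster.
have cW := Chat_cluster_convex W01 HW.
have [s [ss fs]] := cluster_subsequence W01 HW cW.
exists s, (lsc_envelope Omega W); split => //.
  by apply: lsc_envelope_Chat.
by move=> x Ox; rewrite lsc_envelope_interior //; exact: fs.
Qed.

End compactness.

(** * Bounded convergence and Lp norms *)

Lemma cvg_powR0 {R : realType} (p : R) (a : nat -> R) : 0 < p ->
  (forall k, 0 <= a k) -> a k @[k --> \oo] --> 0 -> a k `^ p @[k --> \oo] --> 0.
Proof.
move=> p0 a0 /cvgrPdist_lt ca; apply/cvgrPdist_lt => eps eps0.
have d0 : 0 < eps `^ p^-1 by rewrite powR_gt0.
have [N _ HN] := ca _ d0; exists N => // k Nk; have := HN k Nk.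
rewrite /= !sub0r !normrN !ger0_norm ?powR_ge0 // => H.
have -> : eps = (eps `^ p^-1) `^ p.
  by rewrite -powRrM mulVf ?gt_eqF // powRr1 // ltW.
by apply: gt0_ltr_powR => //; rewrite nnegrE // powR_ge0.
Qed.

Section bounded_integrals.
Context d (T : measurableType d) {R : realType} (mu : {measure set T -> \bar R}).
Variables (D : set T) (mD : measurable D) (D_fin : (mu D < +oo)%E).

Lemma bounded_integrable (h : T -> R) C : measurable_fun D h ->
  (forall x, D x -> `|h x| <= C) -> mu.-integrable D (EFin \o h).
Proof.
move=> mh hC; apply: measurable_bounded_integrable => //.
exists C; split; first exact: num_real.
by move=> M CM x Dx; apply: (le_trans (hC x Dx)); exact: ltW.
Qed.

Lemma bounded_convergence (h_ : nat -> T -> R) (h : T -> R) C :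
  (forall k, measurable_fun D (h_ k)) -> measurable_fun D h ->
  {ae mu, forall x, D x -> h_ k x @[k --> \oo] --> h x} ->
  (forall k x, D x -> `|h_ k x| <= C) ->
  (\int[mu]_(x in D) (h_ k x)%:E @[k --> \oo] --> \int[mu]_(x in D) (h x)%:E)%E.
Proof.
move=> mh_ mh cv hC.
have iC : mu.-integrable D (EFin \o cst C).
  by apply: (@bounded_integrable _ `|C|) => //; exact: measurable_cst.
have [] := @dominated_convergence _ _ _ mu D mD (fun k => EFin \o h_ k)
  (EFin \o h) (EFin \o cst C).
- by move=> k; exact/measurable_EFinP.
- exact/measurable_EFinP.
- by apply: filterS cv => x cvx Dx; apply: cvg_EFin; [exact: nearW|exact: cvx].
- exact: iC.
- by apply: aeW => x k Dx; rewrite lee_fin hC.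
by [].
Qed.

Lemma supported_restrict (h : T -> R) : (forall x, ~ D x -> h x = 0) ->
  (EFin \o h) \_ D = EFin \o h.
Proof.
move=> h0; apply/funext => x; rewrite patchE; case: ifPn => // /negP nD.
by rewrite /= h0 // => Dx; apply: nD; exact/mem_set.
Qed.

Lemma supported_integrable (h : T -> R) C : measurable_fun setT h ->
  (forall x, `|h x| <= C) -> (forall x, ~ D x -> h x = 0) ->
  mu.-integrable setT (EFin \o h).
Proof.
move=> mh hC h0; rewrite -(supported_restrict h0).
apply: (integrable_mkcond _ mD).1.
by apply: (@bounded_integrable _ C) => //; exact: measurable_funTS.
Qed.

Lemma supported_convergence (h_ : nat -> T -> R) (h : T -> R) C :
  (forall k, measurable_fun setT (h_ k)) -> measurable_fun setT h ->
  (forall x, h_ k x @[k --> \oo] --> h x) -> (forall k x, `|h_ k x| <= C) ->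
  (forall k x, ~ D x -> h_ k x = 0) -> (forall x, ~ D x -> h x = 0) ->
  (\int[mu]_x (h_ k x)%:E @[k --> \oo] --> \int[mu]_x (h x)%:E)%E.
Proof.
move=> mh_ mh cv hC h_0 h0.
have E g : (forall x, ~ D x -> g x = 0) ->
    (\int[mu]_x (g x)%:E = \int[mu]_(x in D) (g x)%:E)%E.
  by move=> g0; rewrite [RHS]integral_mkcond (supported_restrict g0).
rewrite (E h) // (_ : (fun k => _) = (fun k => \int[mu]_(x in D) (h_ k x)%:E)%E); last first.
  by apply/funext => k; exact: E (h_0 k).
apply: (@bounded_convergence _ _ C) => //.
- by move=> k; exact: measurable_funTS.
- exact: measurable_funTS.
- by apply: aeW => x _; exact: cv.
Qed.

End bounded_integrals.

Section Lp.
Context {R : realType} {n : nat}.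
Local Notation Rn := 'rV[R]_n.
Local Notation mu := (lebesgue_rV n).
Variables (p : R) (p1 : 1 <= p).
Variables (U : set Rn) (mU : measurable U).

Let p0 : 0 < p. Proof. exact: lt_le_trans ltr01 p1. Qed.

Lemma LpnormE (f : Rn -> R) :
  Lpnorm p U f = ((\int[mu]_(x in U) (`|f x| `^ p)%:E) `^ p^-1)%E.
Proof.
rewrite /Lpnorm unlock; congr (_ `^ _)%E; rewrite [RHS]integral_mkcond.
apply: eq_integral => x _; rewrite !patchE; case: ifPn => //= _.
by rewrite /= normr0 powR0 // gt_eqF.
Qed.

Lemma measurable_powR_norm (f : Rn -> R) : measurable_fun U f ->
  measurable_fun U (fun x => `|f x| `^ p).
Proof.
move=> mf; apply: (@measurableT_comp _ _ _ _ _ _ (@powR R ^~ p)).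
  exact: measurable_powR.
by apply: measurableT_comp => //; exact: measurable_normr.
Qed.

Hypothesis U_fin : (mu U < +oo)%E.

Lemma bounded_Lp (f : Rn -> R) C : measurable_fun U f ->
  (forall x, U x -> `|f x| <= C) -> Lp p U f.
Proof.
move=> mf fC; split => //; rewrite LpnormE; apply: poweR_lty.
have : mu.-integrable U (EFin \o (fun x => `|f x| `^ p)).
  apply: (@bounded_integrable _ _ _ _ _ mU U_fin _ (C `^ p)).
    exact: measurable_powR_norm.
  move=> x Ux; rewrite ger0_norm ?powR_ge0 //.
  apply: ge0_ler_powR; rewrite ?nnegrE ?(ltW p0) // ?fC //.
  exact: le_trans (fC x Ux).
by move=> /(integrable_fin_num mU) /= fin; rewrite ltey_eq fin.
Qed.

Lemma Lpnorm_cvg0 (f : nat -> Rn -> R) C : (forall k, measurable_fun U (f k)) ->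
  {ae mu, forall x, U x -> f k x @[k --> \oo] --> 0} ->
  (forall k x, U x -> `|f k x| <= C) ->
  Lpnorm p U (f k) @[k --> \oo] --> 0%E.
Proof.
move=> mf cf fC.
pose h k x := `|f k x| `^ p.
have mh k : measurable_fun U (h k) by exact: measurable_powR_norm.
have hC k x : U x -> `|h k x| <= C `^ p.
  move=> Ux; rewrite ger0_norm ?powR_ge0 //.
  apply: ge0_ler_powR; rewrite ?nnegrE ?(ltW p0) // ?fC //.
  exact: le_trans (fC k x Ux).
have ch : {ae mu, forall x, U x -> h k x @[k --> \oo] --> 0}.
  apply: filterS cf => x H /H {}H; apply: cvg_powR0 => //.
  by rewrite -[0](@normr0 _ R); exact: cvg_norm.
have := @bounded_convergence _ _ _ mu U mU U_fin h (cst 0) _ mh (measurable_cst _) ch hC.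
have -> : (\int[mu]_(x in U) ((cst 0 : Rn -> R) x)%:E = 0)%E by exact: integral0.
have hfin k : (\int[mu]_(x in U) (h k x)%:E)%E \is a fin_num.
  apply: integrable_fin_num => //.
  exact: (bounded_integrable mU U_fin (mh k) (hC k)).
pose a k := fine (\int[mu]_(x in U) (h k x)%:E)%E.
have aE k : (\int[mu]_(x in U) (h k x)%:E)%E = (a k)%:E by rewrite fineK.
have a0 k : 0 <= a k.
  by rewrite fine_ge0 // integral_ge0 // => x _; rewrite lee_fin powR_ge0.
rewrite (_ : (fun k => _) = (fun k => (a k)%:E)); last by apply/funext.
move=> /fine_cvgP [_ /= ca].
rewrite (_ : (fun k => _) = (fun k => (a k `^ p^-1)%:E)); last first.
  by apply/funext => k; rewrite LpnormE aE poweR_EFin.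
apply: cvg_EFin; first exact: nearW.
by apply: cvg_powR0 => //; rewrite invr_gt0.
Qed.

End Lp.

Section margin.
Context {R : realType} {n : nat}.
Local Notation Rn := 'rV[R]_n.

(** A Lebesgue number: near covering of K, indexed by radii tending to 0 from
    the right. *)
Lemma compact_margin (K A : set Rn) : compact K -> K `<=` A° ->
  exists2 r, 0 < r & forall x z : Rn, K x -> `|z - x| <= r -> A z.
Proof.
move=> /compact_near_coveringP cK KA.
have : \forall r \near (0 : R)^'+, K `<=` (fun x => forall z : Rn, `|z - x| <= r -> A z).
  apply: cK => x Kx; have [r /= r0 rA] := (nbhs_ballP _ _).1 (KA x Kx).
  exists (ball x (r / 2), [set s | s < r / 2]) => /=.
    split; first by apply: nbhsx_ballx; rewrite divr_gt0.
    by apply: nbhs_right_lt; rewrite divr_gt0.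
  move=> [y s] [/= xy sr] z zy; apply: rA; apply: (ball_split xy).
  by rewrite -ball_normE /ball_/= distrC (le_lt_trans zy).
move=> H; have [r [r0 Hr]] : exists r : R, 0 < r /\
    K `<=` (fun x => forall z : Rn, `|z - x| <= r -> A z).
  near (0 : R)^'+ => r; exists r; split => //; near: r; exact: H.
by exists r => // x z Kx; exact: Hr.
Unshelve. all: by end_near. Qed.

End margin.

(** * The weak gradient of a convex function *)

Section test_functions.
Context {R : realType} {n : nat}.
Local Notation Rn := 'rV[R]_n.
Local Notation e_ i := (delta_mx ord0 i : Rn).
Variables (U : set Rn) (phi : Rn -> R) (phi_test : test_function U phi).
Variable i : 'I_n.

Let S : set Rn := closure [set x | phi x != 0].

Lemma test_continuous : continuous phi.
Proof. by have [/(_ [::])[]] := phi_test. Qed.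

Lemma test_derive_continuous : continuous ('D_(e_ i) phi).
Proof. by have [/(_ [:: i])[]] := phi_test. Qed.

Lemma test_derivable x : derivable phi x (e_ i).
Proof. by have [/(_ [::])[_]] := phi_test. Qed.

Lemma test_out x : ~ S x -> phi x = 0.
Proof. by move=> nS; apply: contrapT => /eqP p0; apply: nS; exact: subset_closure. Qed.

(** The complement of the support is open, so phi vanishes on a whole
    neighbourhood. *)
Lemma test_derive_out x : ~ S x -> 'D_(e_ i) phi x = 0.
Proof.
move=> nS; apply/lim_near_cst => //.
have oS : open (~` S) by apply: closed_openC; exact: closed_closure.
have [r r0 Hr] := interior_ray (e_ i) (open_nbhs_nbhs (conj oS nS)).
apply/nbhs_ballP; exists r => // h /=; rewrite /ball /= sub0r normrN => hr _.
by rewrite [_ *: _ + x]addrC !test_out ?subrr ?scaler0 //; exact: Hr (ltW hr).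
Qed.

Let bounded (f : Rn -> R) : continuous f -> (forall x, ~ S x -> f x = 0) ->
  exists2 C, 0 <= C & forall x, `|f x| <= C.
Proof.
move=> cf f0; have [_ cS _] := phi_test.
have : compact (f @` S).
  by apply: continuous_compact => //; exact: continuous_subspaceT.
move=> /compact_bounded [M [_ HM]].
exists (Num.max M 0 + 1); first by rewrite addr_ge0 // le_max lexx orbT.
move=> x; have [Sx|nSx] := pselect (S x).
  by apply: HM; [rewrite ltr_pwDr // le_max lexx|exists x].
by rewrite f0 // normr0 addr_ge0 // le_max lexx orbT.
Qed.

Lemma test_bounded : exists2 C, 0 <= C & forall x, `|phi x| <= C.
Proof. by apply: bounded; [exact: test_continuous|exact: test_out]. Qed.

Lemma test_derive_bounded : exists2 C, 0 <= C & forall x, `|'D_(e_ i) phi x| <= C.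
Proof. by apply: bounded; [exact: test_derive_continuous|exact: test_derive_out]. Qed.

(** Mean value theorem on the segment from x - a e_i to x. *)
Lemma test_lipschitz C x a : (forall x, `|'D_(e_ i) phi x| <= C) -> 0 < a ->
  `|diffq phi (- e_ i) a x| <= C.
Proof.
move=> HC a0; pose y := x - a *: e_ i.
pose psi (t : R) := phi (y + t *: e_ i).
have dpsi (t : R) : is_derive t (1 : R) psi ('D_(e_ i) phi (y + t *: e_ i)).
  have E : (fun h : R => h^-1 *: ((psi \o shift t) (h *: (1 : R)) - psi t)) =
    (fun h : R => h^-1 *: ((phi \o shift (y + t *: e_ i)) (h *: e_ i) - phi (y + t *: e_ i))).
    apply/funext => h; rewrite /psi /= [h *: 1]mulr1 scalerDl.
    by rewrite addrCA.
  split; first by rewrite /derivable E; exact: test_derivable.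
  by rewrite /derive E.
have [|c _] := @MVT R psi _ 0 a a0 (fun t _ => dpsi t).
  apply: continuous_subspaceT => t.
  by apply: differentiable_continuous; apply/derivable1_diffP; have [] := dpsi t.
rewrite /psi scale0r addr0 subr0 [y + a *: _]subrK => H.
rewrite /diffq scalerN -/y -normrN -mulNr opprB H mulfK ?gt_eqF //.
Qed.

Lemma test_diffq_cvg x : diffq phi (- e_ i) k.+1%:R^-1 x @[k --> \oo] --> - 'D_(e_ i) phi x.
Proof.
have s0 : - k.+1%:R^-1 @[k --> \oo] --> (0 : R)^'.
  move=> A /nbhs_ballP [r /= r0 rA].
  have [N _ HN] := near_infty_natSinv_lt (PosNum r0).
  exists N => // k Nk; apply: rA; last by rewrite oppr_eq0 invr_eq0 pnatr_eq0.
  rewrite /ball /= sub0r opprK ger0_norm ?invr_ge0 ?ler0n //; exact: HN.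
have D1 : - diffq phi (- e_ i) k.+1%:R^-1 x @[k --> \oo] --> 'D_(e_ i) phi x.
  have := cvg_comp _ _ s0 (@test_derivable x); apply: cvg_trans; apply: near_eq_cvg.
  apply: nearW => k /=; rewrite /diffq [_ *: e_ i + x]addrC scalerN scaleNr.
  by rewrite invrN scaleNr; congr (- _); rewrite [RHS]mulrC.
have := cvgN D1; under eq_cvg do rewrite opprK; exact.
Qed.

End test_functions.

Section weak_gradient.
Context {R : realType} {n : nat}.
Local Notation Rn := 'rV[R]_n.
Local Notation mu := (lebesgue_rV n).
Local Notation e_ i := (delta_mx ord0 i : Rn).
Variables (Omega : set Rn) (Omega_compact : compact Omega)
  (Omega_convex : convex_set (Omega : set (convex_lmodType Rn))).
Variables (u : Rn -> R) (Cu : Chat Omega u).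
Variables (U : set Rn) (UO : U `<=` Omega°).
Variables (phi : Rn -> R) (phi_test : test_function U phi) (i : 'I_n).

Let S : set Rn := closure [set x | phi x != 0].
Let v := u \_ Omega°.
Let e := e_ i.
Let a (k : nat) : R := k.+1%:R^-1.

Let a0 k : 0 < a k. Proof. by rewrite invr_gt0 ltr0n. Qed.

Let a1 k : a k <= 1. Proof. by rewrite invf_le1 ?ltr0n // ler1n. Qed.

Let mv : measurable_fun setT v.
Proof.
apply/(measurable_restrictT _ _).1; last exact: Chat_measurable Cu.
exact: interior_measurable_rV.
Qed.

Let v1 x : `|v x| <= 1.
Proof.
rewrite /v patchE; case: ifPn => [/set_mem /interior_subset Ox|_]; last by rewrite normr0.
have [/(_ x Ox) + _ _] := Cu; rewrite ler_norml; lra.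
Qed.

Let SO : S `<=` Omega°.
Proof. by have [_ _ H] := phi_test; exact: subset_trans H UO. Qed.

Let mphi : measurable_fun setT phi.
Proof.
apply: continuous_measurable_rV; first exact: openT.
by move=> x _; exact: test_continuous phi_test x.
Qed.

Let out x : ~ S x -> phi x = 0. Proof. exact: (test_out (phi := phi)). Qed.

(* F differentiates u forward and G differentiates phi backward; translation
   by a_k e exchanges them. *)
Let F k x := diffq v e (a k) x * phi x.
Let G k x := v x * diffq phi (- e) (a k) x.

Let support_set : exists D : set Rn, [/\ measurable D, (mu D < +oo)%E &
  forall k x, ~ D x -> [/\ F k x = 0, G k x = 0, phi x = 0 & 'D_e phi x = 0]].
Proof.
have [_ cS _] := phi_test; have [b b0 Hb] := compact_norm_bound cS.
pose B := b + `|e|.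
pose D : set Rn := ball 0 (B + 1).
have DB (x : Rn) : D x = (`|x| < B + 1) :> Prop.
  by rewrite /D -ball_normE /ball_/= sub0r normrN.
have mD : measurable D by exact: measurable_rV_ball.
have Dfin : (mu D < +oo)%E.
  by apply: (lebesgue_rV_bounded_lty (B := B + 1) mD) => x; rewrite DB => /ltW.
have outD (x : Rn) : ~ D x -> B < `|x|.
  by rewrite DB => /negP; rewrite -leNgt; apply: lt_le_trans; rewrite ltrDl.
exists D; split => // k x /outD xb.
have nS : ~ S x.
  move=> /Hb; rewrite leNgt => /negP; apply; apply: le_lt_trans xb.
  by rewrite lerDl.
have nSe : ~ S (x + a k *: - e).
  move=> /Hb; rewrite leNgt => /negP; apply.
  have : `|x| <= `|x + a k *: - e| + `|e|.
    rewrite -{1}(addrNK (a k *: e) x) scalerN (le_trans (ler_normD _ _)) //.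
    by rewrite lerD2l normrZ ler_piMl // (gtr0_norm (a0 k)) a1.
  move: xb; rewrite /B; lra.
split; rewrite ?/F ?/G /diffq ?out //; last exact: test_derive_out.
- by rewrite mulr0.
- by rewrite subrr mul0r mulr0.
Qed.

Let F_cvg x : F k x @[k --> \oo] --> dplus Omega u e x * phi x.
Proof.
have [Sx|nSx] := pselect (S x); last first.
  by rewrite /F out // mulr0; under eq_cvg do rewrite mulr0; exact: cvg_cst.
apply: cvgM; last exact: cvg_cst.
have [_ cu _] := Cu; have Ox := SO Sx.
apply: cvg_trans (dplus_cvg (e := e) cu Ox); apply: near_eq_cvg.
have [h h0 H] := interior_ray e (nbhs_interior Ox).
have [N _ HN] := near_infty_natSinv_lt (PosNum h0).
exists N => // k Nk; rewrite /diffq /v !patchE !mem_set //.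
by apply: H; rewrite ger0_norm ?(ltW (a0 _)) //; exact: ltW (HN k Nk).
Qed.

Let G_cvg x : G k x @[k --> \oo] --> - (v x * 'D_e phi x).
Proof.
rewrite -mulrN; apply: cvgM; first exact: cvg_cst.
exact: test_diffq_cvg phi_test _ _.
Qed.

Let mF k : measurable_fun setT (F k).
Proof.
apply: measurable_funM => //; apply: measurable_funM => //.
apply: measurable_funB => //; exact: measurableT_comp mv (measurable_rV_shift _).
Qed.

Let mG k : measurable_fun setT (G k).
Proof.
apply: measurable_funM => //; apply: measurable_funM => //.
apply: measurable_funB => //; exact: measurableT_comp mphi (measurable_rV_shift _).
Qed.

(** On the support of phi small steps stay inside Omega, where the Lipschitz
    bound applies; for the remaining steps the quotient is at most 2 divided
    by a step bounded below. *)
Let F_bounded : exists C, forall k x, `|F k x| <= C.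
Proof.
have [C C0 HC] := test_bounded phi_test.
have [_ cS _] := phi_test.
have SOi : S `<=` (Omega°)°.
  by move=> x Sx; exact: open_nbhs_nbhs (conj (open_interior _) (SO Sx)).
have [r r0 Hr] := compact_margin cS SOi.
have er0 : 0 <= `|e| / r by rewrite divr_ge0 // ltW.
exists (2 * (`|e| / r) * C) => k x.
have [Sx|nSx] := pselect (S x); last first.
  by rewrite /F out // mulr0 normr0 mulr_ge0 // mulr_ge0.
rewrite normrM ler_pM //.
rewrite /diffq normrM normfV (gtr0_norm (a0 k)) ler_pdivrMr //.
have aeE : `|a k *: e| = a k * `|e| by rewrite normrZ gtr0_norm.
have [ar|ra] := leP (a k * `|e|) r; last first.
  apply: (@le_trans _ _ 2).
    rewrite (le_trans (ler_normB _ _)) // -[leRHS]/(1 + 1).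
    by rewrite lerD // v1.
  rewrite -mulrA ler_peMr // mulrAC ler_pdivlMr // mul1r mulrC; exact: ltW.
have Oz z : `|z - x| <= r -> Omega z by move=> zx; apply: interior_subset; exact: Hr zx.
have xe : `|x + a k *: e - x| <= r by rewrite addrAC subrr add0r aeE.
rewrite /v !patchE !mem_set; [|exact: SO|exact: Hr xe].
have [ub cu _] := Cu.
apply: le_trans (convex_lipschitz cu ub r0 Oz xe) _.
rewrite addrAC subrr add0r aeE.
have -> : 2 * (`|e| / r) * a k = a k * `|e| / r + a k * `|e| / r by ring.
by rewrite lerDl divr_ge0 ?mulr_ge0 // ltW.
Qed.

Let G_bounded : exists C, forall k x, `|G k x| <= C.
Proof.
have [C C0 HC] := test_derive_bounded phi_test i.
exists C => k x; rewrite normrM -[C]mul1r ler_pM //.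
exact: (test_lipschitz phi_test).
Qed.

(** Write A x for v x phi (x - a_k e) / a_k and P x for v x phi x / a_k.  Then
    F x = A (x + a_k e) - P x and G x = A x - P x, and A has the same integral
    as its translate. *)
Let integralFG k : (\int[mu]_x (F k x)%:E = \int[mu]_x (G k x)%:E)%E.
Proof.
have [D [mD Dfin HD]] := support_set.
have [CF HF] := F_bounded; have [CG HG] := G_bounded.
have [C C0 HC] := test_bounded phi_test.
pose A x := v x * phi (x - a k *: e) / a k.
pose P x := v x * phi x / a k.
have PB x : `|P x| <= C / a k.
  rewrite /P !normrM normfV (gtr0_norm (a0 k)) ler_pM2r ?invr_gt0 //.
  by rewrite -[C]mul1r ler_pM.
have FE x : F k x = A (x + a k *: e) - P x.
  by rewrite /F /A /P /diffq addrK; ring.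
have GE x : G k x = A x - P x.
  by rewrite /G /A /P /diffq scalerN; ring.
have mP : measurable_fun setT P by apply: measurable_funM => //; exact: measurable_funM.
have mA : measurable_fun setT A.
  apply: measurable_funM => //; apply: measurable_funM => //.
  exact: measurableT_comp mphi (measurable_rV_shift _).
have iP : mu.-integrable setT (EFin \o P).
  apply: (supported_integrable mD Dfin mP PB) => x xD.
  by rewrite /P; have [_ _ -> _] := HD k x xD; rewrite mulr0 mul0r.
have iF : mu.-integrable setT (EFin \o (F k)).
  apply: (supported_integrable mD Dfin (mF k) (HF k)) => x xD.
  by have [] := HD k x xD.
have iG : mu.-integrable setT (EFin \o (G k)).
  apply: (supported_integrable mD Dfin (mG k) (HG k)) => x xD.
  by have [] := HD k x xD.
have : (\int[mu]_x ((F k x)%:E + (P x)%:E) = \int[mu]_x ((G k x)%:E + (P x)%:E))%E.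
  under eq_integral do rewrite -EFinD FE subrK.
  under [RHS]eq_integral do rewrite -EFinD GE subrK.
  rewrite (@integral_shift R n (a k *: e) (EFin \o A)) //.
  exact/measurable_EFinP.
rewrite integralD_EFin // integralD_EFin //.
have Pfin : (\int[mu]_x (P x)%:E)%E \is a fin_num by apply: integrable_fin_num iP.
move=> FPGP.
by rewrite -(addeK (\int[mu]_x (F k x)%:E)%E Pfin) FPGP addeK.
Qed.

(** Pass to the limit in the discrete integration by parts integralFG. *)
Lemma weak_gradient_dplus :
  (\int[mu]_(x in U) (u x * 'D_(e_ i) phi x)%:E =
   - \int[mu]_(x in U) (dplus Omega u (e_ i) x * phi x)%:E)%E.
Proof.
have [D [mD Dfin HD]] := support_set.
have [CF HF] := F_bounded; have [CG HG] := G_bounded.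
have outU x : ~ U x -> ~ S x by have [_ _ SU] := phi_test => nU /SU.
pose P x := v x * 'D_e phi x.
have mdphi : measurable_fun setT ('D_e phi).
  apply: continuous_measurable_rV; first exact: openT.
  by move=> x _; exact: (test_derive_continuous phi_test).
have mP : measurable_fun setT P by exact: measurable_funM.
have outP x : ~ D x -> P x = 0.
  by move=> xD; rewrite /P; have [_ _ _ ->] := HD 0%N x xD; rewrite mulr0.
have iP : mu.-integrable setT (EFin \o P).
  have [C C0 HC] := test_derive_bounded phi_test i.
  apply: (supported_integrable mD Dfin mP (C := C)) => // x.
  by rewrite /P normrM -[C]mul1r ler_pM.
have mdF : measurable_fun setT (fun x => dplus Omega u e x * phi x).
  by apply: (measurable_fun_cvg mF) => x _; exact: F_cvg.
have HcF : (\int[mu]_x (F k x)%:E @[k --> \oo] -->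
    \int[mu]_x (dplus Omega u e x * phi x)%:E)%E.
  apply: (supported_convergence mD Dfin mF mdF F_cvg HF).
    by move=> k x xD; have [] := HD k x xD.
  by move=> x xD; have [_ _ -> _] := HD 0%N x xD; rewrite mulr0.
have HcG : (\int[mu]_x (G k x)%:E @[k --> \oo] --> \int[mu]_x (- P x)%:E)%E.
  apply: (supported_convergence mD Dfin mG _ G_cvg HG).
  - exact: measurableT_comp.
  - by move=> k x xD; have [] := HD k x xD.
  - by move=> x xD; rewrite -/(P x) outP // oppr0.
have : (\int[mu]_x (dplus Omega u e x * phi x)%:E = \int[mu]_x (- P x)%:E)%E.
  rewrite -(cvg_lim (@ereal_hausdorff R) HcF); apply: cvg_lim => //.
  by under eq_cvg do rewrite integralFG.
have -> : (\int[mu]_x (- P x)%:E = - \int[mu]_x (P x)%:E)%E.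
  rewrite -integralN /=; first by apply: eq_integral.
  by apply: integrable_add_def.
have -> : (\int[mu]_x (dplus Omega u e x * phi x)%:E =
    \int[mu]_(x in U) (dplus Omega u e x * phi x)%:E)%E.
  rewrite [RHS]integral_mkcond; apply: eq_integral => x _; rewrite patchE.
  by case: ifPn => // /negP nU; rewrite out ?mulr0 //; apply: outU => Ux; apply/nU/mem_set.
have -> : (\int[mu]_x (P x)%:E = \int[mu]_(x in U) (u x * 'D_e phi x)%:E)%E.
  rewrite [RHS]integral_mkcond; apply: eq_integral => x _; rewrite patchE /P.
  case: ifPn => [/set_mem Ux|/negP nU]; first by rewrite /v patchE mem_set //; exact: UO.
  by rewrite (test_derive_out i) ?mulr0 //; apply: outU => Ux; apply/nU/mem_set.
by move=> ->; rewrite oppeK.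
Qed.

End weak_gradient.

(** * Local Sobolev convergence *)

Section local_sobolev.
Context {R : realType} {n : nat}.
Local Notation Rn := 'rV[R]_n.
Local Notation mu := (lebesgue_rV n).
Local Notation e_ i := (delta_mx ord0 i : Rn).
Variables (Omega : set Rn) (Omega_compact : compact Omega)
  (Omega_convex : convex_set (Omega : set (convex_lmodType Rn))).
Variables (p : R) (p1 : 1 <= p).
Variables (K : set Rn) (K_compact : compact K) (KO : K `<=` Omega°).

Definition dplus_row (u : Rn -> R) (x : Rn) : Rn := \row_i dplus Omega u (e_ i) x.

Let dplus_rowE u i : (fun x => dplus_row u x ord0 i) = dplus Omega u (e_ i).
Proof. by apply/funext => x; rewrite mxE. Qed.

Let mU : measurable K°.
Proof. exact: open_measurable_rV (open_interior _). Qed.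

Let UO : K° `<=` Omega°.
Proof. exact: subset_trans (@interior_subset _ _) KO. Qed.

Let U_fin : (mu K° < +oo)%E.
Proof.
apply: le_lt_trans (compact_lebesgue_lty Omega_compact).
apply: le_measure; rewrite ?inE //; first exact: compact_measurable_rV.
exact: subset_trans UO (@interior_subset _ _).
Qed.

Let Chat_norm_le1 u x : Chat Omega u -> K° x -> `|u x| <= 1.
Proof.
move=> [/(_ x) H _ _] /UO /interior_subset /H; rewrite ler_norml => /andP[-> u0].
by rewrite (le_trans u0).
Qed.

(** K keeps a positive distance from the boundary, so steps of a fixed length
    are available at all its points, and chords of that length have bounded
    slope.  The bound is the same for the whole class. *)
Lemma dplus_locally_bounded i : exists C, forall u, Chat Omega u ->
  forall x, K° x -> `|dplus Omega u (e_ i) x| <= C.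
Proof.
have [r r0 Hr] := compact_margin K_compact KO.
pose h := r / (`|e_ i| + 1).
have e0 : 0 < `|e_ i| + 1 by rewrite ltr_wpDl.
have h0 : 0 < h by rewrite divr_gt0.
have hr : h * `|e_ i| <= r.
  by rewrite /h mulrAC ler_pdivrMr // ler_pM2l // lerDl.
exists h^-1 => u [ub cu _] x Ux.
have Kx : K x by exact: interior_subset.
apply: (dplus_bound cu ub) => //; first exact: UO.
- by apply: Hr Kx _; rewrite addrAC subrr add0r normrZ gtr0_norm.
- by apply: Hr Kx _; rewrite addrAC subrr add0r normrN normrZ gtr0_norm.
Qed.

Let Chat_measurableU u : Chat Omega u -> measurable_fun K° u.
Proof.
move=> Cu; apply: measurable_funS UO (Chat_measurable Cu).
exact: interior_measurable_rV.
Qed.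

Let dplus_measurableU u i : Chat Omega u -> measurable_fun K° (dplus Omega u (e_ i)).
Proof.
move=> Cu; apply: measurable_funS UO (dplus_measurable Cu _).
exact: interior_measurable_rV.
Qed.

Lemma Chat_W1p_gradient u : Chat Omega u -> W1p_gradient p K° u (dplus_row u).
Proof.
move=> Cu; split.
- apply: (bounded_Lp p1 mU U_fin (C := 1)); first exact: Chat_measurableU.
  by move=> x Ux; exact: Chat_norm_le1.
- move=> i; rewrite dplus_rowE; have [C HC] := dplus_locally_bounded i.
  apply: (bounded_Lp p1 mU U_fin (C := C)); first exact: dplus_measurableU.
  by move=> x Ux; exact: HC.
- move=> phi i phi_test.
  rewrite (weak_gradient_dplus Cu UO phi_test i).
  by congr (- _)%E; apply: eq_integral => x _; rewrite mxE.
Qed.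

(** Functions converge everywhere and weak gradients almost everywhere, both
    under uniform bounds on a set of finite measure. *)
Lemma Chat_cvg_W1p (f : nat -> Rn -> R) w : Omega° !=set0 ->
  (forall k, Chat Omega (f k)) -> Chat Omega w ->
  (forall x, Omega° x -> f k x @[k --> \oo] --> w x) ->
  cvg_W1p p K° f w.
Proof.
move=> O0 Cf Cw fw; exists (fun k => dplus_row (f k)), (dplus_row w); split.
- by move=> k; exact: Chat_W1p_gradient.
- exact: Chat_W1p_gradient.
- apply: (Lpnorm_cvg0 p1 mU U_fin (C := 2)).
  + by move=> k; apply: measurable_funB; exact: Chat_measurableU.
  + apply: aeW => x Ux; rewrite -(subrr (w x)).
    by apply: cvgB; [exact: fw (UO Ux)|exact: cvg_cst].
  + move=> k x Ux; rewrite (le_trans (ler_normB _ _)) // -[leRHS]/(1 + 1).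
    by rewrite lerD // Chat_norm_le1.
- move=> i; have [C HC] := dplus_locally_bounded i.
  have -> : (fun k => Lpnorm p K° (fun x => dplus_row (f k) x ord0 i - dplus_row w x ord0 i))
    = (fun k => Lpnorm p K° (fun x => dplus Omega (f k) (e_ i) x - dplus Omega w (e_ i) x)).
    by apply/funext => k; congr Lpnorm; apply/funext => x; rewrite !mxE.
  apply: (Lpnorm_cvg0 p1 mU U_fin (C := C + C)).
  + by move=> k; apply: measurable_funB; exact: dplus_measurableU.
  + apply: filterS (ae_smooth_points Omega_compact Omega_convex Cw O0) => x H Ux.
    have [Ox Hi] := H (interior_subset (UO Ux)).
    rewrite -(subrr (dplus Omega w (e_ i) x)).
    apply: cvgB; last exact: cvg_cst.
    have cf j : convex_function (Omega : set (convex_lmodType Rn)) (f j).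
      by have [] := Cf j.
    have cw : convex_function (Omega : set (convex_lmodType Rn)) w by have [] := Cw.
    exact: (dplus_limit cf cw fw Ox (Hi i)).
  + move=> k x Ux; rewrite (le_trans (ler_normB _ _)) //.
    by rewrite lerD // HC.
Qed.

End local_sobolev.

(** * The energies *)

(** When l = 0 the regularised denominators are positive and tend to 0, which
    matches the convention that the limiting integrand is +oo where the
    gradient vanishes. *)
Lemma cvg_regularized_inverse {R : realType} (g m : nat -> R) (l : R) :
  (forall k, 0 <= g k) -> (forall k, 0 < m k) ->
  g k @[k --> \oo] --> l -> m k @[k --> \oo] --> 0 ->
  ((g k + m k)^-1)%:E @[k --> \oo] --> (if l == 0%R then +oo else (l^-1)%:E)%E.
Proof.
move=> g0 m0 gl mz.
have gml : g k + m k @[k --> \oo] --> l by rewrite -[l]addr0; exact: cvgD.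
case: ifPn => [/eqP l0|l0]; last first.
  by apply: cvg_EFin; [exact: nearW|exact: cvgV].
apply/cvgeyPger => A _.
have A0 : 0 < (`|A| + 1)^-1 by rewrite invr_gt0 ltr_wpDl.
rewrite l0 in gml; have [N _ HN] := cvgr_lt _ gml _ A0.
exists N => // k /HN /= gmk; rewrite lee_fin.
have gm0 : 0 < g k + m k by rewrite ltr_wpDl.
rewrite (le_trans (ler_norm A)) // (le_trans (y := `|A| + 1)) ?lerDl //.
by rewrite -[leLHS]invrK lef_pV2 ?posrE ?invr_gt0 ?ltr_wpDl // ltW.
Qed.

Lemma limn_einf_le {R : realType} (a : nat -> \bar R) (c : \bar R) :
  (forall k, a k <= c)%E -> (limn_einf a <= c)%E.
Proof.
move=> ac; rewrite limn_einf_lim; apply: lime_le; first exact: is_cvg_einfs.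
apply: nearW => k; apply: le_trans (ac k); apply: ereal_inf_lbound.
by exists k => /=.
Qed.

Lemma measurable_fun_limn_einf d (T : measurableType d) (R : realType) (D : set T)
    (f : nat -> T -> \bar R) : (forall k, measurable_fun D (f k)) ->
  measurable_fun D (fun x => limn_einf (f ^~ x)).
Proof.
move=> mf; apply: measurableT_comp => //; apply: measurable_fun_limn_esup => k.
exact: measurableT_comp.
Qed.

Lemma limn_einf_ge {R : realType} (a : nat -> \bar R) (c : \bar R) :
  (\forall k \near \oo, c <= a k)%E -> (c <= limn_einf a)%E.
Proof.
move=> [N _ ca]; rewrite limn_einf_lim; apply: lime_ge; first exact: is_cvg_einfs.
exists N => // k Nk; apply: le_ereal_inf_tmp => _ [j kj <-]; apply: ca.
exact: leq_trans Nk kj.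
Qed.

Section energies.
Context {R : realType} {n : nat}.
Local Notation Rn := 'rV[R]_n.
Local Notation mu := (lebesgue_rV n).
Variables (Omega : set Rn) (Omega_compact : compact Omega)
  (Omega_convex : convex_set (Omega : set (convex_lmodType Rn))).

Lemma sqnorm_ge0 (y : Rn) : 0 <= sqnorm y.
Proof. by apply: sumr_ge0 => i _; exact: sqr_ge0. Qed.

Let g2 (u : Rn -> R) x := sqnorm (gradient Omega u x).

Let jM M u x : \bar R := ((g2 u x + M ^- 2)^-1)%:E.

Let jinf u x : \bar R := if g2 u x == 0%R then +oo%E else ((g2 u x)^-1)%:E.

Let jM_ge0 M u x : (0 <= jM M u x)%E.
Proof. by rewrite lee_fin invr_ge0 addr_ge0 ?sqnorm_ge0 // invr_ge0 sqr_ge0. Qed.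

Let jinf_ge0 u x : (0 <= jinf u x)%E.
Proof. by rewrite /jinf; case: ifP => // _; rewrite lee_fin invr_ge0 sqnorm_ge0. Qed.

Let measurable_inverse (f : Rn -> R) : (forall x, 0 <= f x) ->
  measurable_fun setT f -> measurable_fun setT (fun x => (f x)^-1).
Proof.
move=> f0 mf; under eq_fun do rewrite -powR_inv1 //.
by apply: (@measurableT_comp _ _ _ _ _ _ (@powR R ^~ (-1))) => //; exact: measurable_powR.
Qed.

Let mg2 u : Chat Omega u -> measurable_fun setT (g2 u).
Proof. by move=> Cu; exact: sqnorm_gradient_measurable. Qed.

Let jM_measurable M u : Chat Omega u -> measurable_fun Omega (jM M u).
Proof.
move=> Cu; apply/measurable_EFinP; apply: measurable_funTS; apply: measurable_inverse.
  by move=> x; rewrite addr_ge0 ?sqnorm_ge0 // invr_ge0 sqr_ge0.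
by apply: measurable_funD => //; exact: mg2.
Qed.

Let jinf_measurable u : Chat Omega u -> measurable_fun Omega (jinf u).
Proof.
move=> Cu; apply: measurable_funTS; apply: measurable_fun_ifT => //.
  by apply: measurable_fun_eqr => //; exact: mg2.
apply/measurable_EFinP; apply: measurable_inverse; last exact: mg2.
by move=> x; exact: sqnorm_ge0.
Qed.

Let mOmega : measurable Omega := compact_measurable_rV Omega_compact.

Lemma J_ge0 M u : (0 <= J Omega M u)%E.
Proof. by apply: integral_ge0 => x _; exact: jM_ge0. Qed.

Lemma J_le_Jinf M u : 0 < M -> Chat Omega u -> (J Omega M u <= Jinf Omega u)%E.
Proof.
move=> M0 Cu; apply: (@ge0_le_integral _ _ _ mu Omega mOmega (jM M u) (jinf u)) => //.
- exact: jM_measurable.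
- exact: jinf_measurable.
- move=> x _; rewrite /jinf; case: ifPn => [_|g0]; first exact: leey.
  have gp : 0 < g2 u x by rewrite lt_neqAle eq_sym g0 sqnorm_ge0.
  rewrite lee_fin lef_pV2 ?posrE // ?lerDl ?invr_ge0 ?sqr_ge0 //.
  by rewrite ltr_wpDr // invr_ge0 sqr_ge0.
Qed.

Lemma J_nondecreasing M M' u : 0 < M -> M <= M' -> Chat Omega u ->
  (J Omega M u <= J Omega M' u)%E.
Proof.
move=> M0 MM' Cu; have M'0 := lt_le_trans M0 MM'.
apply: (@ge0_le_integral _ _ _ mu Omega mOmega (jM M u) (jM M' u)) => //.
- exact: jM_measurable.
- exact: jM_measurable.
- move=> x _; rewrite lee_fin lef_pV2 ?posrE ?ltr_wpDl ?sqnorm_ge0 ?invr_gt0 ?exprn_gt0 //.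
  rewrite lerD2l lef_pV2 ?posrE ?exprn_gt0 //.
  by rewrite ler_pXn2r // nnegrE ltW.
Qed.

(** At a common point of differentiability the gradients are vectors of dplus,
    and dplus_limit applies to each coordinate. *)
Lemma gradient_cvg (f : nat -> Rn -> R) w x :
  (forall k, Chat Omega (f k)) -> Chat Omega w ->
  (forall y, Omega° y -> f k y @[k --> \oo] --> w y) ->
  smooth_points Omega w x -> (forall k, smooth_points Omega (f k) x) ->
  g2 (f k) x @[k --> \oo] --> g2 w x.
Proof.
move=> Cf Cw fw wx fx.
have cf j : convex_function (Omega : set (convex_lmodType Rn)) (f j).
  by have [] := Cf j.
have cw : convex_function (Omega : set (convex_lmodType Rn)) w by have [] := Cw.
rewrite /g2 /sqnorm.
apply: (@cvg_big _ _ _ _ xpredT add_continuous) => i _.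
rewrite /= !expr2; under eq_cvg do rewrite expr2.
have gi : gradient Omega (f k) x ord0 i @[k --> \oo] --> gradient Omega w x ord0 i.
  rewrite gradientE // mxE patchE mem_set //.
  under eq_cvg => k do rewrite gradientE // mxE patchE mem_set //.
  by have [Ox Hi] := wx; exact: (dplus_limit cf cw fw Ox (Hi i)).
exact: cvgM.
Qed.

(** Lower semicontinuity of the limiting energy: the integrands converge at
    almost every point, because w and all the countably many f k are
    differentiable there. *)
Lemma Jinf_fatou (f : nat -> Rn -> R) w (M_ : nat -> R) : Omega° !=set0 ->
  (forall k, Chat Omega (f k)) -> Chat Omega w ->
  (forall y, Omega° y -> f k y @[k --> \oo] --> w y) ->
  (forall k, 0 < M_ k) -> M_ k @[k --> \oo] --> +oo ->
  (Jinf Omega w <= limn_einf (fun k => J Omega (M_ k) (f k)))%E.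
Proof.
move=> O0 Cf Cw fw M0 Moo.
have Mz : M_ k ^- 2 @[k --> \oo] --> 0.
  apply/cvgrPdist_lt => eps eps0.
  have [N _ HN] := (cvgryPgt _).1 Moo (eps^-1 + 1).
  exists N => // k /HN /= Mk.
  have e0 : 0 < eps^-1 by rewrite invr_gt0.
  rewrite sub0r normrN ger0_norm ?invr_ge0 ?sqr_ge0 //.
  rewrite -[eps]invrK ltf_pV2 ?posrE ?exprn_gt0 // expr2.
  move: Mk e0; move: (M_ k) (eps^-1) => a b; nra.
apply: le_trans (fatou mu mOmega (f := fun k => jM (M_ k) (f k)) _ _).
- apply: (@ae_ge0_le_integral _ _ _ mu Omega mOmega (jinf w)).
  + by move=> x _; exact: jinf_ge0.
  + exact: jinf_measurable.
  + by move=> x _; apply: limn_einf_ge; apply: nearW => k; exact: jM_ge0.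
  + by apply: measurable_fun_limn_einf => k; exact: jM_measurable.
  + have aef : {ae mu, forall x, forall k, Omega x -> smooth_points Omega (f k) x}.
      by apply: ae_foralln => k; exact: ae_smooth_points.
    apply: filterS2 (ae_smooth_points Omega_compact Omega_convex Cw O0) aef => x wx fx Ox.
    have gw := gradient_cvg Cf Cw fw (wx Ox) (fun k => fx k Ox).
    have := cvg_regularized_inverse _ _ gw Mz.
    move=> /(_ (fun k => sqnorm_ge0 _)) H.
    rewrite (cvg_limn_einf_sup (H _)).1 // => k.
    by rewrite invr_gt0 exprn_gt0.
- by move=> k; exact: jM_measurable.
- by move=> k x _; exact: jM_ge0.
Qed.

Lemma Jinf_lty u c : Omega° !=set0 -> Chat Omega u -> 0 < c ->
  (forall x, smooth_points Omega u x -> c <= sqnorm (gradient Omega u x)) ->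
  (Jinf Omega u < +oo)%E.
Proof.
move=> O0 Cu c0 Hc.
apply: (@le_lt_trans _ _ (\int[mu]_(x in Omega) (cst (c^-1)%:E x))%E).
  apply: (@ae_ge0_le_integral _ _ _ mu Omega mOmega (jinf u)) => //.
  - exact: jinf_measurable.
  - by move=> x _; rewrite lee_fin invr_ge0 ltW.
  - apply: filterS (ae_smooth_points Omega_compact Omega_convex Cu O0) => x ux Ox.
    have cg : c <= g2 u x by exact: Hc (ux Ox).
    have g0 : 0 < g2 u x by exact: lt_le_trans cg.
    by rewrite /jinf gt_eqF // lee_fin lef_pV2.
rewrite integral_cst // lte_mul_pinfty ?lee_fin ?invr_ge0 ?(ltW c0) //.
exact: compact_lebesgue_lty.
Qed.

(** The affine function x |-> (x_0 - B) / (2B), where B bounds the norm on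
    Omega: its gradient has constant length 1/(2B). *)
Lemma Chat_finite_energy : (0 < n)%N -> Omega° !=set0 ->
  exists2 v, Chat Omega v & (Jinf Omega v < +oo)%E.
Proof.
move=> n0 O0; have [B B0 HB] := compact_norm_bound Omega_compact.
pose i0 : 'I_n := Ordinal n0.
pose v (x : Rn) : R := (x ord0 i0 - B) / (B *+ 2).
have B2 : 0 < B *+ 2 by rewrite mulrn_wgt0.
have cv : convex_function (Omega : set (convex_lmodType Rn)) v.
  move=> t x y _ _.
  suff : v (t%:num *: (x : Rn) + (1 - t%:num) *: (y : Rn)) <=
      t%:num * v x + (1 - t%:num) * v y by [].
  by rewrite /v !mxE le_eqVlt; apply/orP; left; apply/eqP; ring.
have Cv : Chat Omega v.
  split => //.
  - move=> x Ox; have := le_trans (rV_coord_le_norm x i0) (HB x Ox).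
    rewrite ler_norml /v ler_pdivlMr // ler_pdivrMr // mul0r mulN1r.
    by move=> /andP[? ?]; apply/andP; split; rewrite ?mulr2n; lra.
  - move=> x a; rewrite lte_fin => ax.
    exists [set y | a < v y]; last by move=> y /=; rewrite lte_fin.
    have cvx (z : Rn) : {for z, continuous v}.
      apply: (@continuous_comp _ _ _ (fun y : Rn => y ord0 i0)
        (fun t : R => (t - B) / (B *+ 2))); first exact: coord_continuous.
      apply: cvgM; last exact: cvg_cst.
      by apply: cvgB; [exact: cvg_id|exact: cvg_cst].
    have nx (z : Rn) : a < v z -> nbhs z [set y : Rn | a < v y].
      by move=> az; exact: (cvx z [set y | a < y] (open_nbhs_nbhs (conj (@open_gt _ a) az))).
    by case: (@nbhs_subspaceP _ Omega x) => [_|_ _ -> //]; apply: filterS (nx x ax) => y.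
have dv (e x : Rn) : Omega° x -> dplus Omega v e x = e ord0 i0 / (B *+ 2).
  move=> Ox; rewrite -(cvg_lim (@Rhausdorff R) (dplus_cvg (e := e) cv Ox)).
  apply: cvg_lim => //; apply: cvg_near_cst; apply: nearW => k.
  have k0 : (k.+1%:R : R) != 0 by rewrite pnatr_eq0.
  rewrite /diffq /v !mxE.
  by field; rewrite gt_eqF //= addrC natr1.
exists v => //; apply: (Jinf_lty (c := (B *+ 2)^-1 ^+ 2)) => //.
  by rewrite exprn_gt0 // invr_gt0.
move=> x [Ox sx]; rewrite /sqnorm (bigD1 i0) //= gradientE // mxE patchE mem_set //.
by rewrite dv // mxE !eqxx mul1r lerDl sumr_ge0 // => j _; exact: sqr_ge0.
Qed.

End energies.

(** * Limits of minimizers *)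

Section accumulation.
Context {R : realType} {n : nat}.
Local Notation Rn := 'rV[R]_n.
Local Notation mu := (lebesgue_rV n).
Variables (p : R) (p1 : 1 <= p).

(** Fatou for |f k - g|^p shows that its liminf vanishes almost everywhere;
    where g x <> w x this liminf would be at least (|w x - g x| / 2)^p. *)
Lemma Lpnorm_limit_unique (U : set Rn) (f : nat -> Rn -> R) (g w : Rn -> R) :
  measurable U -> (forall k, measurable_fun U (f k)) ->
  measurable_fun U g -> measurable_fun U w ->
  Lpnorm p U (fun x => f k x - g x) @[k --> \oo] --> 0%E ->
  (forall x, U x -> f k x @[k --> \oo] --> w x) ->
  {ae mu, forall x, U x -> g x = w x}.
Proof.
move=> mU mf mg mw fg fw.
have p0 : 0 < p by exact: lt_le_trans p1.
pose h k x := `|f k x - g x| `^ p.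
have mh k : measurable_fun U (h k).
  by apply: measurable_powR_norm; exact: measurable_funB.
pose L k := Lpnorm p U (fun x => f k x - g x).
have L0 k : (0 <= L k)%E by exact: Lnorm_ge0.
have intE k : (\int[mu]_(x in U) (h k x)%:E = L k `^ p)%E.
  rewrite /L LpnormE // -poweRrM mulVf ?gt_eqF // poweRe1 //.
  by apply: integral_ge0 => x Ux; rewrite lee_fin powR_ge0.
have int0 : (\int[mu]_(x in U) (h k x)%:E @[k --> \oo] --> 0)%E.
  have /fine_cvgP[[N _ Lfin] Lz] : L k @[k --> \oo] --> 0%E by exact: fg.
  apply/fine_cvgP; split.
    by exists N => // k /Lfin Lk; rewrite intE -(fineK Lk) poweR_EFin.
  apply: cvg_trans (cvg_powR0 p0 (fun k => fine_ge0 (L0 k)) Lz).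
  apply: near_eq_cvg; exists N => // k /Lfin Lk /=.
  by rewrite intE -[in RHS](fineK Lk) poweR_EFin.
pose l x := limn_einf (fun k => (h k x)%:E).
have l0 x : (0 <= l x)%E.
  by apply: limn_einf_ge; apply: nearW => k; rewrite lee_fin powR_ge0.
have ml : measurable_fun U l.
  by apply: measurable_fun_limn_einf => k; apply/measurable_EFinP.
have intl : (\int[mu]_(x in U) `|l x| = 0)%E.
  apply/eqP; rewrite eq_le integral_ge0 // andbT.
  under eq_integral do rewrite gee0_abs //.
  rewrite -(cvg_limn_einf_sup int0).1; apply: fatou => //.
    by move=> k; apply/measurable_EFinP.
  by move=> k x _; rewrite lee_fin powR_ge0.
apply: filterS ((ae_eq_integral_abs mu mU ml).1 intl) => x lx Ux.
apply: contrapT => gwx.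
have d0 : 0 < `|w x - g x| / 2.
  by rewrite divr_gt0 // normr_gt0 subr_eq0; apply/eqP => wg; exact: gwx.
pose c := (`|w x - g x| / 2) `^ p.
have : (c%:E <= l x)%E.
  apply: limn_einf_ge.
  have /cvgrPdist_lt /(_ _ d0) [N _ HN] := fw x Ux.
  exists N => // k /HN /= fk; rewrite lee_fin.
  apply: ge0_ler_powR; rewrite ?nnegrE ?(ltW p0) ?(ltW d0) //.
  have := ler_distD (f k x) (w x) (g x); lra.
by rewrite lx //= lee_fin leNgt powR_gt0.
Qed.

Variables (Omega : set Rn) (Omega_compact : compact Omega)
  (Omega_convex : convex_set (Omega : set (convex_lmodType Rn)))
  (Omega_interior : Omega° !=set0).

(** The interiors of countably many closed rational balls cover the interior
    of Omega, and the boundary is null. *)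
Lemma W1p_loc_limit_unique (f : nat -> Rn -> R) (g w : Rn -> R) :
  W1p_loc p Omega g -> cvg_W1p_loc p Omega f g ->
  (forall k, Chat Omega (f k)) -> Chat Omega w ->
  (forall x, Omega° x -> f k x @[k --> \oo] --> w x) ->
  {ae mu, forall x, Omega x -> g x = w x}.
Proof.
move=> Wg fg Cf Cw fw.
pose K (q : 'rV[rat]_n * nat) : set Rn :=
  [set x | `|x - map_mx ratr q.1| <= q.2.+1%:R^-1].
pose N q : set Rn := if `[< K q `<=` Omega° >]
  then [set x | (K q)° x /\ g x <> w x] else set0.
apply: (@negligibleS _ _ _ _ ((Omega `\` Omega°) `|` \bigcup_q N q)).
  move=> x /= /not_implyP[Ox gw].
  have [iOx|nOx] := pselect (Omega° x); last by left.
  right; have oO : nbhs x Omega° by exact: open_nbhs_nbhs (conj (open_interior _) iOx).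
  have [c [m [xc cO]]] := rational_ball oO.
  have m0 : 0 < m.+1%:R^-1 :> R by rewrite invr_gt0.
  exists (c, m) => //; rewrite /N; case: asboolP => [_|[]].
    split=> //.
    have ob : open (ball (map_mx ratr c : Rn) m.+1%:R^-1) by exact: ball_open.
    apply: filterS (open_nbhs_nbhs (conj ob xc)) => y.
    by rewrite -ball_normE /ball_/= distrC => /ltW.
  move=> y yc; apply: cO; rewrite -ball_normE /ball_/= distrC (le_lt_trans yc) //.
  by rewrite mulr2n ltrDl.
apply: negligibleU; first exact: boundary_negligible.
apply: negligible_countable_bigcup => q; rewrite /N; case: asboolP => KO; last first.
  exact: negligible_set0.
have cK : compact (K q).
  apply: bounded_closed_compact.
    exists (`|map_mx ratr q.1 : Rn| + q.2.+1%:R^-1); split; first exact: num_real.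
    move=> M hM x Kx; apply: le_trans (ltW hM).
    rewrite -{1}(subrK (map_mx ratr q.1) x) (le_trans (ler_normD _ _)) // addrC.
    by rewrite lerD2l.
  have -> : K q = (closed_ball (map_mx ratr q.1 : Rn) q.2.+1%:R^-1).
    rewrite closed_ballE ?invr_gt0 //; apply/seteqP; split => x;
    by rewrite /closed_ball_ /= distrC.
  exact: closed_ball_closed.
have UO : (K q)° `<=` Omega° by exact: subset_trans (@interior_subset _ _) KO.
have mC v : Chat Omega v -> measurable_fun (K q)° v.
  move=> Cv; apply: measurable_funS UO (Chat_measurable Cv).
  exact: interior_measurable_rV.
have [_ [[mg _] _ _]] := Wg _ cK KO.
have [_ [_ [_ _ fgK _]]] := fg _ cK KO.
apply: negligibleS (Lpnorm_limit_unique (w := w) _ _ mg _ fgK _).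
- by move=> x /= [Ux gw] H; exact: gw (H Ux).
- exact: interior_measurable_rV.
- by move=> k; exact: mC.
- exact: mC.
- by move=> x Ux; exact: fw (UO _ Ux).
Qed.

End accumulation.

Section minimizers.
Context {R : realType} {n : nat}.
Local Notation Rn := 'rV[R]_n.
Local Notation mu := (lebesgue_rV n).
Variables (Omega : set Rn) (Omega_compact : compact Omega)
  (Omega_convex : convex_set (Omega : set (convex_lmodType Rn)))
  (Omega_interior : Omega° !=set0).
Variables (u : R -> Rn -> R)
  (u_min : forall M, 0 < M -> minimizer (Chat Omega) (J Omega M) (u M)).

Let uC M : 0 < M -> Chat Omega (u M). Proof. by move=> /u_min[]. Qed.

Lemma minimal_energy_le M v : 0 < M -> Chat Omega v ->
  (J Omega M (u M) <= Jinf Omega v)%E.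
Proof.
move=> M0 Cv; apply: (@le_trans _ _ (J Omega M v)); last first.
  exact: (J_le_Jinf Omega_compact Omega_convex M0 Cv).
by have [_] := u_min M0; apply.
Qed.

Lemma minimal_energy_nondecreasing M M' : 0 < M -> M <= M' ->
  (J Omega M (u M) <= J Omega M' (u M'))%E.
Proof.
move=> M0 MM'; have M'0 := lt_le_trans M0 MM'.
apply: (@le_trans _ _ (J Omega M (u M'))); last first.
  by apply: J_nondecreasing => //; exact: uC.
by have [_] := u_min M0; apply; exact: uC.
Qed.

Section sequence.
Variables (M_ : nat -> R) (M0 : forall k, 0 < M_ k)
  (Moo : M_ k @[k --> \oo] --> +oo).
Variables (w : Rn -> R) (Cw : Chat Omega w)
  (uw : forall x, Omega° x -> u (M_ k) x @[k --> \oo] --> w x).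

Lemma Jinf_le_limit :
  (Jinf Omega w <= limn_einf (fun k => J Omega (M_ k) (u (M_ k))))%E.
Proof. by apply: Jinf_fatou => // k; exact: uC. Qed.

Lemma limit_minimizer : minimizer (Chat Omega) (Jinf Omega) w.
Proof.
split; first exact: Cw.
move=> v Cv.
apply: le_trans Jinf_le_limit _.
apply: limn_einf_le => k.
exact: minimal_energy_le (M0 k) Cv.
Qed.

(** The values are bounded by Jinf w and nondecreasing in M, and along M_ they
    come arbitrarily close to Jinf w, so they converge as M tends to +oo. *)
Lemma minimal_energy_cvg : (Jinf Omega w < +oo)%E ->
  J Omega M (u M) @[M --> +oo] --> Jinf Omega w.
Proof.
move=> Loo.
have L0 : (0 <= Jinf Omega w)%E.
  exact: le_trans (J_ge0 Omega 1 w) (J_le_Jinf Omega_compact Omega_convex ltr01 Cw).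
have Lfin : Jinf Omega w \is a fin_num by rewrite ge0_fin_numE.
have JL M : 0 < M -> (J Omega M (u M) <= Jinf Omega w)%E.
  by move=> M0'; exact: minimal_energy_le.
have Jfin M : 0 < M -> J Omega M (u M) \is a fin_num.
  by move=> M0'; rewrite ge0_fin_numE ?J_ge0 // (le_lt_trans (JL M M0')).
rewrite -(fineK Lfin); apply/fine_cvgP; split.
  by near=> M; apply: Jfin; near: M; apply: nbhs_pinfty_gt; exact: num_real.
apply/cvgrPdist_lt => eps eps0.
have [k Hk] : exists k, ((fine (Jinf Omega w) - eps)%:E < J Omega (M_ k) (u (M_ k)))%E.
  apply: contrapT => H.
  have : (Jinf Omega w <= (fine (Jinf Omega w) - eps)%:E)%E.
    apply: le_trans Jinf_le_limit _; apply: limn_einf_le => k.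
    by rewrite leNgt; apply/negP => Hk; apply: H; exists k.
  by rewrite -{1}(fineK Lfin) lee_fin; lra.
near=> M.
have MM : M_ k <= M by near: M; apply: nbhs_pinfty_ge; exact: num_real.
have M0' : 0 < M by exact: lt_le_trans MM.
have := lt_le_trans Hk (minimal_energy_nondecreasing (M0 k) MM).
have := JL M M0'; rewrite -(fineK (Jfin M M0')) -(fineK Lfin) lee_fin lte_fin /=.
move=> H1 H2; rewrite ger0_norm; lra.
Unshelve. all: by end_near. Qed.

End sequence.
End minimizers.

Lemma increasing_cvg_oo (s : nat -> nat) : {homo s : i j / (i < j)%N} ->
  s k @[k --> \oo] --> \oo.
Proof.
move=> hs; have sk k : (k <= s k)%N.
  by elim: k => // k IH; exact: leq_ltn_trans IH (hs _ _ (ltnSn k)).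
by move=> A [N _ HN]; exists N => // k Nk; apply: HN; exact: leq_trans Nk (sk k).
Qed.

Lemma cvg_W1p_loc_subsequence {R : realType} {n : nat} (p : R)
    (Omega : set 'rV[R]_n) (f_ : nat -> 'rV[R]_n -> R) f (s : nat -> nat) :
  {homo s : i j / (i < j)%N} -> cvg_W1p_loc p Omega f_ f ->
  cvg_W1p_loc p Omega (fun k => f_ (s k)) f.
Proof.
move=> /increasing_cvg_oo soo cf K cK KO.
have [g_ [g [Hg Hgf cfK cgK]]] := cf K cK KO.
exists (fun k => g_ (s k)), g; split => //; first exact: cvg_comp soo cfK.
by move=> i; exact: cvg_comp soo (cgK i).
Qed.

Theorem theorem2 (R : realType) (n : nat) (hn : (0 < n)%N)
  (Omega : set 'rV[R]_n) (Omega_compact : compact Omega)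
  (Omega_convex : convex_set Omega) (Omega_interior : Omega° !=set0)
  (p : R) (hp : 1 <= p) (u : R -> 'rV[R]_n -> R)
  (hu : forall M, 0 < M -> minimizer (Chat Omega) (J Omega M) (u M)) :
  (forall M_ : nat -> R,
     (forall k, 0 < M_ k) -> nondecreasing_seq M_ -> M_ k @[k --> \oo] --> +oo ->
     (exists f, accumulation_point p Omega (fun k => u (M_ k)) f) /\
     (forall f, accumulation_point p Omega (fun k => u (M_ k)) f ->
        exists w, minimizer (Chat Omega) (Jinf Omega) w /\
          {ae lebesgue_rV n, forall x, Omega x -> f x = w x})) /\
  (exists w, [/\ minimizer (Chat Omega) (Jinf Omega) w,
     (Jinf Omega w < +oo)%E &
     J Omega M (u M) @[M --> +oo] --> Jinf Omega w]).
Proof.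
have Cu M : 0 < M -> Chat Omega (u M) by move=> /hu[].
split.
  move=> M_ M0 _ Moo.
  have CuM k : Chat Omega (u (M_ k)) by exact: Cu.
  split.
    have [s [w [hs Cw sw]]] := Chat_sequentially_compact Omega_convex CuM.
    exists w; split.
      move=> K cK KO; exists (dplus_row Omega w).
      exact: Chat_W1p_gradient.
    exists s; split => // K cK KO.
    exact: (Chat_cvg_W1p Omega_compact Omega_convex hp cK KO Omega_interior _ Cw sw).
  move=> f [Wf [s [hs cvf]]].
  have Cus k : Chat Omega (u (M_ (s k))) by exact: CuM.
  (* f is determined up to null sets only; a further subsequence converges at
     every interior point to a member of the class, which represents f. *)
  have [s' [w [hs' Cw sw]]] := Chat_sequentially_compact Omega_convex Cus.
  exists w; split.
    apply: (limit_minimizer Omega_compact Omega_convex Omega_interior hu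
      (M_ := fun k => M_ (s (s' k)))) => //.
    by apply: cvg_comp Moo; apply: cvg_comp (increasing_cvg_oo hs); exact: increasing_cvg_oo.
  apply: (W1p_loc_limit_unique hp Omega_compact Omega_convex Omega_interior Wf _ _ Cw sw) => //.
  exact: (cvg_W1p_loc_subsequence hs' cvf).
(* Any sequence tending to +oo yields the minimizer; monotonicity in M extends
   the limit from the sequence to all M. *)
pose M_ k : R := k.+1%:R.
have M0 k : 0 < M_ k by rewrite ltr0n.
have Moo : M_ k @[k --> \oo] --> +oo.
  apply: (@cvg_comp _ _ _ succn (fun k => k%:R : R)); last exact: cvgr_idn.
  by apply: increasing_cvg_oo => i j; rewrite ltnS.
have CuM k : Chat Omega (u (M_ k)) by exact: Cu.
have [s [w [hs Cw sw]]] := Chat_sequentially_compact Omega_convex CuM.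
have Msoo : M_ (s k) @[k --> \oo] --> +oo.
  exact: cvg_comp (increasing_cvg_oo hs) Moo.
have wmin : minimizer (Chat Omega) (Jinf Omega) w.
  by apply: (limit_minimizer Omega_compact Omega_convex Omega_interior hu
    (M_ := fun k => M_ (s k))).
have [v Cv voo] := Chat_finite_energy Omega_compact Omega_convex hn Omega_interior.
have woo : (Jinf Omega w < +oo)%E by apply: le_lt_trans voo; exact: wmin.2.
exists w; split => //.
by apply: (minimal_energy_cvg Omega_compact Omega_convex Omega_interior hu
  (M_ := fun k => M_ (s k))).
Qed.
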